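(* The spectrum of the operator $\mathcal A$ associated with the boundary value problem \[ \frac{\partial^2u}{\partial t^2}+\frac{\partial^2}{\partial r^2}\Big[E\frac{\partial^2u}{\partial r^2}+C\frac{\partial^3u}{\partial r^2\partial t}\Big]+K\frac{\partial^2u}{\partial t\,\partial r}=0,\quad r\in(0,1),\ t>0,\qquad u=\frac{\partial^2u}{\partial r^2}=0\ \text{ at } r=0 \text{ and } r=1, \] satisfies the inclusion \[ \sigma(\mathcal A)\subset\Big\{\lambda\in\mathbb C\ \Big|\ \mathrm{Re}\,\lambda<0,\ \Big||\mathrm{Re}\,\lambda|-\frac\beta2\Big|^2\ge\Big(\frac\beta2\Big)^2\Big(1-\frac4{\beta\delta}\Big),\ |\mathrm{Im}\,\lambda|\le h(|\mathrm{Re}\,\lambda|)\Big\}, \] where \[ h(t)=\begin{cases}\dfrac{kt}{1-\frac2\beta t},&0\le t<\lambda_{\rm i,ii},\\[2ex]\sqrt{\dfrac\beta\delta\,\dfrac t{\beta-t}-t^2},&\lambda_{\rm i,ii}\le t\le\lambda_{\rm ii,iii},\\[2ex]h_{\rm iii}(t),&\lambda_{\rm ii,iii}<t<\infty,\end{cases} \] with $\lambda_{\rm i,ii}=\frac\beta2\big(1-\frac k{k_\mu}\big)$ and $\lambda_{\rm ii,iii}=\frac\beta2\big(1+\frac k{k_\mu}\big)$; in particular, there is a spectral free strip if $\beta\delta>4$, namely \[ \mathrm{Re}\,\sigma(\mathcal A)\cap\Big(-\frac{C\pi^4}2\Big(1+\sqrt{1-\frac{4E}{C^2\pi^4}}\Big),\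 -\frac{C\pi^4}2\Big(1-\sqrt{1-\frac{4E}{C^2\pi^4}}\Big)\Big)=\emptyset\qquad\text{if } C>\frac{2\sqrt E}{\pi^2}. \]
   Context: $E,C,K>0$ are constants and $H=L^2(0,1)$ (complex-valued) with inner product $\langle\cdot,\cdot\rangle$ and norm $\|\cdot\|$. $A_0=E\frac{\mathrm d^4}{\mathrm dr^4}$ with $\mathcal D(A_0)=\{z\in H^4(0,1)\mid z(0)=z(1)=z''(0)=z''(1)=0\}$; $A_0$ is self-adjoint and uniformly positive. $H_{1/2}:=\mathcal D(A_0^{1/2})=\{z\in H^2(0,1)\mid z(0)=z(1)=0\}$ with $\langle z,v\rangle_{H_{1/2}}=E\langle z'',v''\rangle$. $H_{-1/2}$ is the dual of $H_{1/2}$ with respect to the pivot space $H$, with duality pairing $\langle\cdot,\cdot\rangle_{H_{-1/2}\times H_{1/2}}$ extending the inner product of $H$. $A_0$ extends to a bounded operator $H_{1/2}\to H_{-1/2}$, and $D=\frac CE A_0+K\frac{\mathrm d}{\mathrm dr}:H_{1/2}\to H_{-1/2}$, i.e. $\langle Dz,v\rangle_{H_{-1/2}\times H_{1/2}}=C\langle z'',v''\rangle+K\langle z',v\rangle$. The operator $\mathcal A$ in $H_{1/2}\times H$ associated with the boundary value problem is \[ \mathcal A=\begin{bmatrix}0&I\\-A_0&-D\end{bmatrix},\qquad\mathcal D(\mathcal A)=\{(z,w)^\top\in H_{1/2}\times H_{1/2}\mid A_0z+Dw\in H\}. \] The constants are \[ \beta=C\pi^4,\quad\delta=\frac CE,\quad\mu=\frac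 C{\sqrt E}\pi^2,\quad k=\frac K{C\pi^3}, \] $k_\mu\ge0$ is defined by \[ k_\mu^2=\frac2{\mu^2}+\frac{k^2-1}2+\sqrt{\Big(\frac2{\mu^2}+\frac{k^2-1}2\Big)^2+k^2}, \] and $h_{\rm iii}(t)$, $t\in[0,\infty)$, is the largest non-negative solution $y$ of $(y^2+t^2)(y-kt)=\frac2\delta\,ty$. $\mathrm{Re}\,\sigma(\mathcal A)=\{\mathrm{Re}\,\lambda\mid\lambda\in\sigma(\mathcal A)\}$. The value of $h(t)$ is only needed for those $t\ge0$ satisfying $|t-\frac\beta2|^2\ge(\frac\beta2)^2(1-\frac4{\beta\delta})$; for such $t\in[\lambda_{\rm i,ii},\lambda_{\rm ii,iii}]$ the radicand is non-negative. *)

(* Defs.v *)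
From HB Require Import structures.
From mathcomp Require Import all_boot all_order all_algebra.
From mathcomp Require Import complex.
From mathcomp Require Import all_classical all_reals all_analysis.
Set Implicit Arguments.
Unset Strict Implicit.
Unset Printing Implicit Defensive.
Import Order.TTheory GRing.Theory Num.Theory.
Local Open Scope classical_set_scope.
Local Open Scope ring_scope.

(* A Hilbert space is represented by a set [X] of vectors of [V] together with
   its (semi)norm [nrm]: vectors whose difference has norm 0 are identified
   (for L^2 this is equality almost everywhere).  An unbounded operator is
   given by its graph [T]: [T x y] means that [x] lies in the domain and that
   [y] is (a representative of) its image. *)
Section Spectrum.
Variables (R : realType) (V : lmodType R[i]).
Variables (X : set V) (nrm : V -> R) (T : V -> V -> Prop).

(* [T - lam] is injective, onto [X], and its inverse is bounded *)
Definition resolvent_set : set R[i] :=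
  [set lam | [/\ forall x y, T x y -> nrm (y - lam *: x) = 0 -> nrm x = 0,
                 forall f, X f ->
                   exists x y, T x y /\ nrm (y - lam *: x - f) = 0 &
                 exists M : R, forall x y, T x y ->
                   nrm x <= M * nrm (y - lam *: x)]].

Definition spectrum : set R[i] := ~` resolvent_set.

End Spectrum.

Section Spaces.
Variable R : realType.

(* The regular algebra [R[i]^o] provides the complex vector space structure
   on functions.  Only the values on [0, 1] matter. *)
Local Notation cfun := (R -> R[i]^o).

Local Notation mu := (@lebesgue_measure R).
Local Notation I01 := (`[0%R, 1%R]%classic : set R).

Definition cintegral (D : set R) (f : R -> R[i]) : R[i] :=
  Complex (\int[mu]_(x in D) (complex.Re (f x) : R))
          (\int[mu]_(x in D) (complex.Im (f x) : R)).

(* H = L^2(0,1); the end points form a null set *)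
Definition L2 : set cfun :=
  [set f | [/\ measurable_fun I01 (fun x => complex.Re (f x) : R),
               measurable_fun I01 (fun x => complex.Im (f x) : R) &
               mu.-integrable I01
                 (fun x => (complex.Re (f x) ^+ 2 + complex.Im (f x) ^+ 2 : R)%:E)]].

Definition ip (f g : cfun) : R[i] :=
  cintegral I01 (fun x => (f x : R[i]) * conjc (g x)).

(* [f] is absolutely continuous on [0, 1] with derivative [g] in L^2(0,1) *)
Definition is_deriv (f g : cfun) : Prop :=
  L2 g /\ forall x : R, 0 <= x <= 1 ->
    f x = f 0 + cintegral (`[0%R, x]%classic) g.

Definition is_derivs (z : cfun) (d : cfun * cfun) : Prop :=
  is_deriv z d.1 /\ is_deriv d.1 d.2.

Definition H2 : set cfun := [set z | exists d, is_derivs z d].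

(* For [z] in H^2(0,1) the first component is determined everywhere on [0, 1]
   and the second one almost everywhere. *)
Definition derivs (z : cfun) : cfun * cfun := xget (0, 0) (is_derivs z).
Definition d1 (z : cfun) : cfun := (derivs z).1.
Definition d2 (z : cfun) : cfun := (derivs z).2.

Definition Hhalf : set cfun := [set z | [/\ H2 z, z 0 = 0 & z 1 = 0]].

Definition ip_half (E : R) (z v : cfun) : R[i] :=
  real_complex R E * ip (d2 z) (d2 v).

(* Elements of H_{-1/2} are represented as antilinear functionals on H_{1/2};
   an element [f] of H acts by [v |-> ip f v].  [A0] is the bounded extension
   of E d^4/dr^4 to H_{1/2}: <A0 z, v> = <z, v>_{1/2} = E <z'', v''>. *)
Definition A0 (E : R) (z : cfun) : cfun -> R[i] := fun v => ip_half E z v.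

Definition Dop (E C K : R) (z : cfun) : cfun -> R[i] :=
  fun v => real_complex R (C / E) * A0 E z v
           + real_complex R K * ip (d1 z) v.

Local Notation state := (cfun * cfun)%type.

Definition Hstate : set state := [set x | Hhalf x.1 /\ L2 x.2].

Definition norm_state (E : R) (x : state) : R :=
  Num.sqrt (complex.Re (ip_half E x.1 x.1) + complex.Re (ip x.2 x.2)).

(* (z, w) is in the domain when A_0 z + D w, a priori in H_{-1/2}, is given by
   some f in H; then (z, w) is mapped to (w, - f). *)
Definition calA (E C K : R) (x y : state) : Prop :=
  [/\ Hhalf x.1, Hhalf x.2, y.1 = x.2, L2 y.2 &
      forall v, Hhalf v -> A0 E x.1 v + Dop E C K x.2 v = ip (- y.2) v].

Definition sigmaA (E C K : R) : set R[i] :=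
  spectrum Hstate (norm_state E) (calA E C K).

End Spaces.

Section Constants.
Variables (R : realType) (E C K : R).

Definition beta : R := C * pi ^+ 4.
Definition delta : R := C / E.
Definition mu_ : R := C / Num.sqrt E * pi ^+ 2.
Definition k_ : R := K / (C * pi ^+ 3).

Definition k_mu : R :=
  let q := 2 / mu_ ^+ 2 + (k_ ^+ 2 - 1) / 2 in
  Num.sqrt (q + Num.sqrt (q ^+ 2 + k_ ^+ 2)).

Definition lam12 : R := beta / 2 * (1 - k_ / k_mu).
Definition lam23 : R := beta / 2 * (1 + k_ / k_mu).

Definition h3_sol (t : R) : set R :=
  [set y | 0 <= y /\ (y ^+ 2 + t ^+ 2) * (y - k_ * t) = 2 / delta * t * y].

(* the largest element of [h3_sol t] *)
Definition h3 (t : R) : R :=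
  xget 0 [set y | h3_sol t y /\ forall y', h3_sol t y' -> y' <= y].

Definition h (t : R) : R :=
  if t < lam12 then k_ * t / (1 - 2 / beta * t)
  else if t <= lam23 then
    Num.sqrt (beta / delta * (t / (beta - t)) - t ^+ 2)
  else h3 t.

End Constants.

(* Main.v *)
From HB Require Import structures.
From mathcomp Require Import all_boot all_order all_algebra.
From mathcomp Require Import complex.
From mathcomp Require Import all_classical all_reals all_analysis.
From mathcomp Require Import measurable_realfun ring lra.
Require Import Defs.
Set Implicit Arguments.
Unset Strict Implicit.
Unset Printing Implicit Defensive.
Import Order.TTheory GRing.Theory Num.Theory.
Import numFieldNormedType.Exports.
Local Open Scope classical_set_scope.
Local Open Scope ring_scope.

(** Writing an element of the domain as (z, w), the equation
    (A - lam) (z, w) = (f, g) forces w = lam z + f and leaves one equation for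
    z, whose left-hand side is the pencil lam^2 + lam D + A0.  Its quadratic
    form on H_{1/2} is

      (1 + lam delta) a + lam K <z', z> + lam^2 |z|^2,  where a = E |z''|^2.

    Since z vanishes at both ends, <z', z> is purely imaginary, and the
    inequalities pi |z| <= |z'| and pi |z'| <= |z''| ([poincare1], [poincare2])
    bound |z|^2 by (delta / beta) a and K |<z', z>| by k delta a
    ([dirichlet_im]).  Divided by a, the form is therefore a value of
    1 + lam delta + i lam kappa + lam^2 n on a fixed compact rectangle of pairs
    (n, kappa).  Elementary algebra shows that a zero of this function on the
    rectangle puts lam into the region of the theorem ([symb_zero_region]); this
    includes the edge n = 0, which corresponds to a infinite.  So for lam
    outside the region compactness gives a positive lower bound, that is,
    coercivity of the form on H_{1/2} ([symb_bounded_below],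
    [pencil_coercive]).  Coercivity gives injectivity of A - lam and the bound
    on its inverse ([resolvent_bound]).

    Surjectivity is obtained by solving the equation explicitly.  With b = E + lam C, which
    is nonzero because the lower bound applies at n = kappa = 0, the function
    zeta = z + (C / b) f has to solve

      b zeta'''' + lam K zeta' + lam^2 zeta = G in L^2,
      zeta = zeta'' = 0 at both ends.

    Factoring the characteristic polynomial over the complex numbers turns the
    equation into four first-order equations, solved by variation of constants;
    the boundary conditions become a square linear system for the four initial
    values, and coercivity makes its kernel trivial ([quartic_bvp_exists],
    [resolvent_onto]).

    Derivatives are understood through integrals, f x = f 0 + int_0^x g with g
    in L^2, so the calculus rests on two facts: the product rule, which is
    Fubini's theorem on a triangle ([int_product], [primM]), and uniqueness of
    g up to a null set, which is Lebesgue's differentiation theorem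
    ([prim_unique]). *)

(** * Square-integrable real functions on the unit interval *)

Section SquareIntegrable.
Variable R : realType.
Local Notation mu := (@lebesgue_measure R).
Local Notation I01 := (`[0%R, 1%R]%classic : set R).
Local Notation integ01 f := (mu.-integrable I01 (EFin \o (f : R -> R))).
Local Notation int01 f := (\int[mu]_(x in I01) (f x : R)).

Definition sqint (f : R -> R) :=
  measurable_fun I01 f /\ integ01 (fun x => f x ^+ 2).

Lemma integ_mono (f g : R -> R) : measurable_fun I01 f ->
  (forall x, I01 x -> `|f x| <= g x) -> integ01 g -> integ01 f.
Proof.
move=> mf fg ig; apply: (le_integrable _ _ _ ig) => //.
  exact/measurable_EFinP.
by move=> x Ix /=; rewrite lee_fin (le_trans (fg x Ix))// ler_norm.
Qed.

Lemma integ_cst (c : R) : integ01 (fun=> c).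
Proof.
apply: measurable_bounded_integrable => //=; last exact: bounded_cst.
by rewrite /= lebesgue_measure_itv/= lte_fin ltr01 oppr0 adde0 ltry.
Qed.

Lemma integ_eq (f g : R -> R) : (forall x, I01 x -> f x = g x) -> integ01 f -> integ01 g.
Proof. by move=> fg; apply: eq_integrable => // x /set_mem/fg /= ->. Qed.

Lemma integD (f g : R -> R) : integ01 f -> integ01 g -> integ01 (fun x => f x + g x).
Proof.
move=> hf hg; have := @integrableD _ _ _ mu _ (measurable_itv _) _ _ hf hg.
exact: eq_integrable.
Qed.

Lemma integZ (c : R) (f : R -> R) : integ01 f -> integ01 (fun x => c * f x).
Proof.
move=> hf; have := @integrableZl _ _ _ mu _ (measurable_itv _) c _ hf.
exact: eq_integrable.
Qed.

Lemma integ_meas (f : R -> R) : integ01 f -> measurable_fun I01 f.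
Proof. by move=> /(measurable_int mu) /measurable_EFinP. Qed.

Lemma sqintM (f g : R -> R) : sqint f -> sqint g -> integ01 (fun x => f x * g x).
Proof.
move=> [mf f2] [mg g2].
apply: (@integ_mono _ (fun x => f x ^+ 2 + g x ^+ 2)).
- exact: measurable_funM.
- move=> x _; rewrite ler_norml; apply/andP; split; nra.
- exact: integD.
Qed.

Lemma sqint_bounded (f : R -> R) (M : R) : measurable_fun I01 f ->
  (forall x, I01 x -> `|f x| <= M) -> sqint f.
Proof.
move=> mf fM; split=> //; apply: (@integ_mono _ (fun=> M ^+ 2)).
- exact: measurable_funX.
- move=> x Ix; rewrite normrX; rewrite lerXn2r ?nnegrE ?fM//.
  exact: le_trans (fM x Ix).
- exact: integ_cst.
Qed.

Lemma sqint_cst (c : R) : sqint (fun=> c).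
Proof. by apply: (@sqint_bounded _ `|c|). Qed.

Lemma sqint_integ (f : R -> R) : sqint f -> integ01 f.
Proof.
move=> sf; have := sqintM sf (sqint_cst 1).
by apply: integ_eq => x _; rewrite mulr1.
Qed.

Lemma sqintZ (c : R) (f : R -> R) : sqint f -> sqint (fun x => c * f x).
Proof.
move=> [mf f2]; split; first by apply: measurable_funM.
by have := integZ (c ^+ 2) f2; apply: integ_eq => x _; rewrite exprMn.
Qed.

Lemma sqintD (f g : R -> R) : sqint f -> sqint g -> sqint (fun x => f x + g x).
Proof.
move=> sf sg; have [mf f2] := sf; have [mg g2] := sg.
split; first exact: measurable_funD.
apply: (@integ_eq (fun x => (f x ^+ 2 + g x ^+ 2) + 2 * (f x * g x))).
- by move=> x _; ring.
- apply: integD; first exact: integD.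
  by apply: integZ; exact: sqintM.
Qed.

(** Meant for an absolutely continuous f and a derivative g, so that only f is
    bounded. *)
Lemma sqint_mulb (f g : R -> R) (M : R) : measurable_fun I01 f ->
  (forall x, I01 x -> `|f x| <= M) -> sqint g -> sqint (fun x => f x * g x).
Proof.
move=> mf fM [mg g2]; split; first exact: measurable_funM.
apply: (@integ_mono _ (fun x => M ^+ 2 * g x ^+ 2)).
- by apply: measurable_funX; exact: measurable_funM.
- move=> x Ix; rewrite normrX normrM exprMn (real_normK (num_real (g x))).
  rewrite ler_wpM2r ?sqr_ge0// lerXn2r ?nnegrE ?fM//.
  exact: le_trans (fM x Ix).
- exact: integZ.
Qed.

Lemma eq_int01 (f g : R -> R) : (forall x, I01 x -> f x = g x) -> int01 f = int01 g.
Proof. by move=> fg; apply: eq_Rintegral => x /set_mem; exact: fg. Qed.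

Lemma int01D (f g : R -> R) : integ01 f -> integ01 g ->
  int01 (fun x => f x + g x) = int01 f + int01 g.
Proof. exact: RintegralD. Qed.

Lemma int01Z (c : R) (f : R -> R) : integ01 f ->
  int01 (fun x => c * f x) = c * int01 f.
Proof. exact: RintegralZl. Qed.

Lemma int01_cst (c : R) : int01 (fun=> c) = c.
Proof.
by rewrite Rintegral_cst//= lebesgue_measure_itv/= lte_fin ltr01 oppr0 adde0 mulr1.
Qed.

Lemma I0x_sub (x : R) : x <= 1 -> `[0, x]%classic `<=` I01.
Proof.
move=> x1 y /=; rewrite !in_itv/= => /andP[-> yx]/=; exact: le_trans yx x1.
Qed.

Lemma integ_sub (x : R) (f : R -> R) : x <= 1 -> integ01 f ->
  mu.-integrable `[0, x]%classic (EFin \o f).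
Proof.
move=> x1; apply: integrableS => //.
exact: I0x_sub.
Qed.

End SquareIntegrable.

Section ProductIntegral.
Variable R : realType.
Local Notation mu := (@lebesgue_measure R).
Local Notation I01 := (`[0%R, 1%R]%classic : set R).
Local Notation integ01 f := (mu.-integrable I01 (EFin \o (f : R -> R))).

(** Fubini's theorem for f(s) g(u) on the half-plane s < u. *)
Lemma triangle_Fubini (f g : R -> R) :
  mu.-integrable setT (EFin \o f) -> mu.-integrable setT (EFin \o g) ->
  (\int[mu]_s (f s * \int[mu]_u (g u * (s < u)%R%:R))) =
  \int[mu]_u (g u * \int[mu]_s (f s * (s < u)%R%:R)) :> R.
Proof.
move=> fi gi.
have mf : measurable_fun setT f by move/(measurable_int mu)/measurable_EFinP : fi.
have mg : measurable_fun setT g by move/(measurable_int mu)/measurable_EFinP : gi.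
have lt01 (s u : R) : 0 <= ((s < u)%R%:R : R) <= 1.
  by case: (s < u); rewrite ?lexx ?ler01.
pose K (p : R * R) := f p.1 * (g p.2 * (p.1 < p.2)%R%:R).
have mind : measurable_fun [set: R * R] (fun p : R * R => ((p.1 < p.2)%R%:R : R)).
  apply: (@measurableT_comp _ _ _ _ _ _ (fun b : bool => (b%:R : R))) => //.
  exact: measurable_fun_ltr.
have mK : measurable_fun [set: R * R] K.
  apply: measurable_funM; first exact: measurableT_comp.
  by apply: measurable_funM => //; exact: measurableT_comp.
have gsi s : mu.-integrable setT (EFin \o (fun u => g u * (s < u)%R%:R)).
  apply: (le_integrable _ _ _ gi) => //.
  - apply/measurable_EFinP/measurable_funM => //.
    apply: (@measurableT_comp _ _ _ _ _ _ (fun b : bool => (b%:R : R))) => //.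
    exact: measurable_fun_ltr.
  - move=> u _ /=; rewrite lee_fin normrM ler_piMr//.
    by have /andP[h0 h1] := lt01 s u; rewrite ger0_norm.
have fui u : mu.-integrable setT (EFin \o (fun s => f s * (s < u)%R%:R)).
  apply: (le_integrable _ _ _ fi) => //.
  - apply/measurable_EFinP/measurable_funM => //.
    apply: (@measurableT_comp _ _ _ _ _ _ (fun b : bool => (b%:R : R))) => //.
    exact: measurable_fun_ltr.
  - move=> s _ /=; rewrite lee_fin normrM ler_piMr//.
    by have /andP[h0 h1] := lt01 s u; rewrite ger0_norm.
have Ki : (mu \x mu)%E.-integrable setT (EFin \o K).
  apply/integrable12ltyP; first exact/measurable_EFinP.
  have gabs : (\int[mu]_u `|g u|%:E < +oo)%E by case/integrableP : gi.
  have gabs0 : (0 <= \int[mu]_u `|g u|%:E)%E.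
    by apply: integral_ge0 => u _; rewrite lee_fin.
  apply: (@le_lt_trans _ _
     (\int[mu]_s (`|f s|%:E * \int[mu]_u (`|g u|%:E)))%E).
    apply: ge0_le_integral => //.
    - by move=> s _; apply: integral_ge0.
    - have := @measurable_fun_fubini_tonelli_F _ _ _ _ _ mu (abse \o (EFin \o K)).
      apply; last by move=> p /=; rewrite lee_fin.
      by apply: measurableT_comp => //; exact/measurable_EFinP.
    - apply: emeasurable_funM => //.
      by apply/measurable_EFinP; exact: measurableT_comp.
    - move=> s _; rewrite -ge0_integralZl//; last first.
        by apply/measurable_EFinP; exact: measurableT_comp.
      apply: ge0_le_integral => //.
      + apply: measurableT_comp => //; apply/measurable_EFinP.
        rewrite /K/=; apply: measurable_funM => //.
        by have /(measurable_int mu)/measurable_EFinP := gsi s.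
      + by apply: emeasurable_funM => //; apply/measurable_EFinP; exact: measurableT_comp.
      + move=> u _ /=; rewrite -EFinM lee_fin !normrM ler_wpM2l// ler_piMr//.
        by have /andP[h0 h1] := lt01 s u; rewrite ger0_norm.
  rewrite -(fineK (_ : (\int[mu]_u `|g u|%:E)%E \is a fin_num)); last first.
    by rewrite ge0_fin_numE.
  rewrite ge0_integralZr//; last 2 first.
  - by apply/measurable_EFinP; exact: measurableT_comp.
  - by rewrite lee_fin fine_ge0.
  apply: lte_mul_pinfty => //; [exact: integral_ge0| |exact: ltry].
  by rewrite ge0_fin_numE; [case/integrableP : fi|exact: integral_ge0].
have := Fubini Ki => /(congr1 fine).
rewrite /Rintegral /K => FK.
transitivity (fine (\int[mu]_x \int[mu]_y (EFin \o K) (x, y))%E).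
  congr fine; apply: eq_integral => s _ /=; rewrite /K /=.
  rewrite EFinM fineK; last exact: (integrable_fin_num _ (gsi s)).
  by rewrite -integralZl//; exact: gsi.
rewrite (Fubini Ki); congr fine; apply: eq_integral => u _ /=; rewrite /K /=.
rewrite EFinM fineK; last exact: (integrable_fin_num _ (fui u)).
rewrite -integralZl//; last exact: fui.
by apply: eq_integral => s _ /=; rewrite -EFinM; congr EFin; ring.
Qed.

Lemma integ_prim_continuous (g : R -> R) : integ01 g ->
  {within I01, continuous (fun x => \int[mu]_(t in `[0, x]) g t)}.
Proof. by move=> ig; exact: parameterized_integral_continuous. Qed.

Lemma cont_measurable (f : R -> R) : {within I01, continuous f} -> measurable_fun I01 f.
Proof. by move=> cf; exact: subspace_continuous_measurable_fun. Qed.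

Lemma cont_bounded (f : R -> R) : {within I01, continuous f} ->
  exists M, forall x, I01 x -> `|f x| <= M.
Proof.
move=> cf; have [c _ hc] := EVT_max ler01 cf; have [d _ hd] := EVT_min ler01 cf.
exists (`|f c| + `|f d|) => x Ix.
rewrite ler_norml; apply/andP; split.
- have := hd x Ix; have := ler_norm (- f d); rewrite normrN; have := normr_ge0 (f c); lra.
- have := hc x Ix; have := ler_norm (f c); have := normr_ge0 (f d); lra.
Qed.

Lemma cont_sqint (f : R -> R) : {within I01, continuous f} -> sqint f.
Proof.
move=> cf; have [M fM] := cont_bounded cf.
exact: (sqint_bounded (cont_measurable cf) fM).
Qed.

Lemma Rintegral_restrictM (D : set R) (f h : R -> R) :
  \int[mu]_s ((f \_ D) s * h s) = \int[mu]_(s in D) (f s * h s).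
Proof.
rewrite [RHS]Rintegral_mkcond; apply: eq_Rintegral => s _.
by rewrite !patchE; case: ifP => // _; rewrite mul0r.
Qed.

(** The square [0, x]^2 is cut along its diagonal: the first integral is the
    part u < s of the double integral of f(s) g(u), and by [triangle_Fubini]
    the second one is the part s < u. *)
Lemma int_product (x : R) (f g : R -> R) : 0 <= x <= 1 -> integ01 f -> integ01 g ->
  \int[mu]_(s in `[0, x]) (f s * \int[mu]_(t in `[0, s]) g t)
  + \int[mu]_(s in `[0, x]) (g s * \int[mu]_(t in `[0, s]) f t)
  = \int[mu]_(s in `[0, x]) f s * \int[mu]_(s in `[0, x]) g s.
Proof.
move=> /andP[x0 x1] if1 ig1.
have ifx := integ_sub x1 if1; have igx := integ_sub x1 ig1.
have [Mg gM] := cont_bounded (integ_prim_continuous ig1).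
have igG : integ01 (fun s => f s * \int[mu]_(t in `[0, s]) g t).
  apply: (@integ_mono _ _ (fun s => Mg * `|f s|)).
  - apply: measurable_funM; first exact: integ_meas.
    by apply: cont_measurable; exact: integ_prim_continuous.
  - by move=> s Is; rewrite normrM mulrC ler_wpM2r// gM.
  - by apply: integZ; exact: integrable_norm.
have igG' := integ_sub x1 igG.
have D1 : mu.-integrable setT (EFin \o (f \_ `[0, x])).
  by rewrite -restrict_EFin; apply/integrable_restrict => //=; rewrite setTI.
have D2 : mu.-integrable setT (EFin \o (g \_ `[0, x])).
  by rewrite -restrict_EFin; apply/integrable_restrict => //=; rewrite setTI.
have := triangle_Fubini D1 D2; rewrite !Rintegral_restrictM.
under eq_Rintegral => s sx.
  rewrite Rintegral_restrictM.
  have -> : \int[mu]_(t in `[0, x]) (g t * (s < t)%R%:R) =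
     \int[mu]_(t in `[0, x]) g t - \int[mu]_(t in `[0, s]) g t.
    move: sx => /set_mem/=; rewrite in_itv/= => /andP[s0 sx].
    rewrite (Rintegral_itvB igx) ?bnd_simp//.
    rewrite [LHS]Rintegral_mkcond [RHS]Rintegral_mkcond; apply: eq_Rintegral => t _.
    rewrite !patchE !mem_setE !in_itv/=.
    case: (ltrP s t) => st; rewrite ?mulr1 ?mulr0 ?if_same//=.
    by rewrite (le_trans s0 (ltW st)).
  over.
move=> E.
have E2 : \int[mu]_(u in `[0, x]) (g u * \int[mu]_s ((f \_ `[0, x]) s * (s < u)%R%:R))
   = \int[mu]_(u in `[0, x]) (g u * \int[mu]_(s in `[0, u]) f s).
  apply: eq_Rintegral => u /set_mem/=; rewrite in_itv/= => /andP[u0 ux].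
  congr (_ * _); rewrite Rintegral_restrictM -[RHS]Rintegral_itv_bndo_bndc; last first.
    move: ifx; apply: integrableS => // t /=; rewrite !in_itv/= => /andP[-> tu]/=.
    exact: ltW (lt_le_trans tu ux).
  rewrite [LHS]Rintegral_mkcond [RHS]Rintegral_mkcond; apply: eq_Rintegral => t _.
  rewrite !patchE !mem_setE !in_itv/=.
  case: (ltrP t u) => tu; rewrite ?mulr1 ?mulr0 ?if_same//= ?andbF//.
  by rewrite (le_trans (ltW tu) ux).
rewrite E2 in E; rewrite -E.
rewrite -RintegralD//; last first.
  apply: integ_sub => //.
  apply: (integ_eq _ (integD (integZ (\int[mu]_(t in `[0, x]) g t) if1) (integZ (-1) igG))).
  by move=> s _ /=; ring.
rewrite -RintegralZr//; apply: eq_Rintegral => s _; ring.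
Qed.

End ProductIntegral.

(** * Absolutely continuous functions with square-integrable derivative *)

Section Primitives.
Variable R : realType.
Local Notation mu := (@lebesgue_measure R).
Local Notation I01 := (`[0%R, 1%R]%classic : set R).
Local Notation int01 f := (\int[mu]_(x in I01) (f x : R)).

Definition prim (f g : R -> R) :=
  sqint g /\ forall x, 0 <= x <= 1 -> f x = f 0 + \int[mu]_(t in `[0, x]) g t.

Lemma prim_continuous f g : prim f g -> {within I01, continuous f}.
Proof.
move=> [sg fg].
have h : {within I01, continuous (fun x => f 0 + \int[mu]_(t in `[0, x]) g t)}.
  move=> x; apply: cvgD; first exact: cvg_cst.
  exact: integ_prim_continuous (sqint_integ sg) x.
apply: subspace_eq_continuous h => x /set_mem/=; rewrite in_itv/= => Ix.
by rewrite /from_subspace (fg x).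
Qed.

Lemma prim_sqint f g : prim f g -> sqint f.
Proof. by move=> /prim_continuous/cont_sqint. Qed.

Lemma prim_cst (c : R) : prim (fun=> c) (fun=> 0).
Proof.
by split; [exact: sqint_cst|move=> x _; rewrite Rintegral_cst//= mul0r addr0].
Qed.

Lemma primD f g u v : prim f g -> prim u v ->
  prim (fun x => f x + u x) (fun x => g x + v x).
Proof.
move=> [sg fg] [sv uv]; split; first exact: sqintD.
move=> x Ix; rewrite RintegralD//; first by rewrite (fg x)// (uv x)//; ring.
- by apply: integ_sub; [case/andP : Ix|exact: sqint_integ].
- by apply: integ_sub; [case/andP : Ix|exact: sqint_integ].
Qed.

Lemma primZ (c : R) f g : prim f g -> prim (fun x => c * f x) (fun x => c * g x).
Proof.
move=> [sg fg]; split; first exact: sqintZ.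
move=> x Ix; rewrite RintegralZl//; first by rewrite (fg x)//; ring.
by apply: integ_sub; [case/andP : Ix|exact: sqint_integ].
Qed.

(** Inserting f = f 0 + int f' and g = g 0 + int g' into the integral of the
    derivative reduces the product rule to [int_product]. *)
Lemma primM f f' g g' : prim f f' -> prim g g' ->
  prim (fun x => f x * g x) (fun x => f' x * g x + f x * g' x).
Proof.
move=> pf pg; have [sf ff] := pf; have [sg gg] := pg.
have [Mf fM] := cont_bounded (prim_continuous pf).
have [Mg gM] := cont_bounded (prim_continuous pg).
have mf := cont_measurable (prim_continuous pf).
have mg := cont_measurable (prim_continuous pg).
have s1 : sqint (fun x => f' x * g x).
  have -> : (fun x => f' x * g x) = (fun x => g x * f' x) by apply/funext => x; ring.
  exact: sqint_mulb gM sf.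
have s2 : sqint (fun x => f x * g' x) by exact: sqint_mulb fM sg.
split; first exact: sqintD.
move=> x Ix; have x1 : x <= 1 by case/andP : Ix.
have if' := sqint_integ sf; have ig' := sqint_integ sg.
have := int_product Ix if' ig'.
have Isub t : `[0, x]%classic t -> 0 <= t <= 1.
  by rewrite /= in_itv/= => /andP[-> tx]/=; exact: le_trans tx x1.
have -> : \int[mu]_(s in `[0, x]) (f' s * \int[mu]_(t in `[0, s]) g' t) =
  \int[mu]_(s in `[0, x]) (f' s * g s) - g 0 * \int[mu]_(s in `[0, x]) (f' s).
  rewrite -RintegralZl//; last exact: integ_sub.
  rewrite -RintegralB//; last 2 first.
  - by apply: integ_sub => //; exact: sqint_integ.
  - by apply: integ_sub => //; exact: integZ.
  by apply: eq_Rintegral => s /set_mem/Isub Is; rewrite (gg s)//; ring.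
have -> : \int[mu]_(s in `[0, x]) (g' s * \int[mu]_(t in `[0, s]) f' t) =
  \int[mu]_(s in `[0, x]) (f s * g' s) - f 0 * \int[mu]_(s in `[0, x]) (g' s).
  rewrite -RintegralZl//; last exact: integ_sub.
  rewrite -RintegralB//; last 2 first.
  - by apply: integ_sub => //; exact: sqint_integ.
  - by apply: integ_sub => //; exact: integZ.
  by apply: eq_Rintegral => s /set_mem/Isub Is; rewrite (ff s)//; ring.
rewrite RintegralD//; last 2 first.
- by apply: integ_sub => //; exact: sqint_integ.
- by apply: integ_sub => //; exact: sqint_integ.
rewrite (ff x)// (gg x)//.
by move=> E; lra.
Qed.

Lemma int01_by_parts f f' g g' : prim f f' -> prim g g' ->
  int01 (fun x => f' x * g x + f x * g' x) = f 1 * g 1 - f 0 * g 0.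
Proof.
move=> pf pg; have [_ /(_ 1)] := primM pf pg.
by rewrite ler01 lexx => /(_ isT) ->; ring.
Qed.

(** The difference h of two derivatives has vanishing integral over every
    [0, x]; at almost every point the derivative of its (zero) primitive is h. *)
Lemma prim_unique f g g' : prim f g -> prim f g' ->
  int01 (fun x => (g x - g' x) ^+ 2) = 0.
Proof.
move=> [sg fg] [sg' fg'].
pose h x := g x - g' x; pose k := h \_ I01.
have sh : sqint h.
  have := sqintD sg (sqintZ (-1) sg').
  by congr sqint; apply/funext => x; rewrite /h; ring.
have kT : mu.-integrable setT (EFin \o k).
  rewrite -restrict_EFin; apply/integrable_restrict => //=; rewrite setTI.
  exact: sqint_integ.
(* The primitive starts at -1, not at 0, because it is differentiated only at
   points beyond its starting point and these have to cover [0, 1]. *)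
have F0 : (fun x => \int[mu]_(t in `[-1, x]) k t) = cst 0.
  apply/funext => x /=; have [x0|x0] := ltrP x 0.
    transitivity (\int[mu]_(t in `[-1, x]) (0 : R)); last by rewrite Rintegral_cst//= mul0r.
    apply: eq_Rintegral => t /set_mem/=; rewrite in_itv/= => /andP[_ tx].
    by rewrite /k patchE mem_setE in_itv/= leNgt (le_lt_trans tx x0).
  have h0 y : 0 <= y <= 1 -> \int[mu]_(t in `[0, y]) h t = 0.
    move=> Iy; have y1 : y <= 1 by case/andP : Iy.
    rewrite RintegralB//; last 2 first.
    - by apply: integ_sub => //; exact: sqint_integ.
    - by apply: integ_sub => //; exact: sqint_integ.
    by have := fg y Iy; rewrite (fg' y)// => /addrI ->; rewrite subrr.
  have -> : \int[mu]_(t in `[-1, x]) k t = \int[mu]_(t in `[0, Num.min x 1]) h t.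
    rewrite [LHS]Rintegral_mkcond [RHS]Rintegral_mkcond; apply: eq_Rintegral => t _.
    rewrite /k !patchE !mem_setE !in_itv/= le_min.
    case: (lerP 0 t) => t0; last by rewrite if_same.
    by rewrite (le_trans _ t0) ?lerN10//=; case: (t <= x).
  by apply: h0; rewrite le_min x0 ler01/= ge_min lexx orbT.
have := @FTC1 R k (BLeft (-1)).
have i1 : forall y, mu.-integrable [set` Interval (BLeft (-1)) (BRight y)] (EFin \o k).
  by move=> y; apply: integrableS kT.
have i2 : locally_integrable [set: R] k.
  by apply: integrable_locally_restrict => //; exact: sqint_integ.
move=> /(_ i1 i2)/=; rewrite F0 => ae.
transitivity (int01 (fun=> 0)); last by rewrite Rintegral_cst//= mul0r.
congr fine; apply: ae_eq_integral => //.
- by apply/measurable_EFinP; have [_ /(@integ_meas R)] := sh.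
- move: ae; apply: filterS; first exact: (ae_filter_ringOfSetsType mu).
  move=> x hx /= Ix.
  move: (Ix); rewrite /= in_itv/= => /andP[x0 x1].
  have [] := hx; first by rewrite lte_fin (lt_le_trans _ x0)// ltrN10.
  move=> _; rewrite derive1E derive_cst /k patchE mem_set// => /esym.
  by rewrite /h => ->; rewrite expr0n.
Qed.

End Primitives.

(** * Explicit primitives and the Wirtinger inequality *)

Section Wirtinger.
Variable R : realType.
Local Notation mu := (@lebesgue_measure R).
Local Notation I01 := (`[0%R, 1%R]%classic : set R).
Local Notation int01 f := (\int[mu]_(x in I01) (f x : R)).

Lemma is_derive_continuous (f : R -> R) (x df : R) :
  is_derive x 1 f df -> {for x, continuous f}.
Proof.
by move=> [df1 _]; apply: differentiable_continuous; exact/derivable1_diffP.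
Qed.

Lemma prim_C1 (F f : R -> R) : (forall x : R, 0 <= x <= 1 -> is_derive x 1 F (f x)) ->
  {within I01, continuous f} -> prim F f.
Proof.
move=> dF cf; split; first exact: cont_sqint.
move=> x /andP[]; rewrite le_eqVlt => /predU1P[<-|x0] x1.
  by rewrite set_itv1 Rintegral_set1 addr0.
have cF y : 0 <= y <= 1 -> {for y, continuous F}.
  by move=> Iy; exact: (is_derive_continuous (dF y Iy)).
have := @continuous_FTC2 R f F 0 x x0.
rewrite /Rintegral => ->; last 3 first.
- by apply: continuous_subspaceW cf; exact: I0x_sub.
- split.
  + move=> y; rewrite in_itv/= => /andP[y0 y1].
    by have [] := dF y _; rewrite ?(ltW y0)//= (le_trans (ltW y1)).
  + by apply: cvg_at_right_filter; apply: cF; rewrite lexx ler01.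
  + by apply: cvg_at_left_filter; apply: cF; rewrite (ltW x0).
- move=> y; rewrite in_itv/= => /andP[y0 y1].
  rewrite derive1E; apply: derive_val.
  by apply: dF; rewrite (ltW y0)//= (le_trans (ltW y1)).
by rewrite /=; ring.
Qed.

Lemma prim_exp (a : R) : prim (fun x => expR (a * x)) (fun x => a * expR (a * x)).
Proof.
have dexp (x : R) : is_derive x 1 (fun x => expR (a * x)) (a * expR (a * x)).
  by apply: is_derive_eq; rewrite /GRing.scale/=; ring.
apply: prim_C1 => //; apply: continuous_subspaceT => x.
apply: cvgM; first exact: cvg_cst.
exact: (is_derive_continuous (dexp x)).
Qed.

Lemma prim_cos (b : R) : prim (fun x => cos (b * x)) (fun x => - b * sin (b * x)).
Proof.
have dcos (x : R) : is_derive x 1 (fun x => cos (b * x)) (- b * sin (b * x)).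
  by apply: is_derive_eq; rewrite /GRing.scale/=; ring.
have dsin (x : R) : is_derive x 1 (fun x => sin (b * x)) (b * cos (b * x)).
  by apply: is_derive_eq; rewrite /GRing.scale/=; ring.
apply: prim_C1 => //; apply: continuous_subspaceT => x.
apply: cvgM; first exact: cvg_cst.
exact: (is_derive_continuous (dsin x)).
Qed.

Lemma prim_sin (b : R) : prim (fun x => sin (b * x)) (fun x => b * cos (b * x)).
Proof.
have dcos (x : R) : is_derive x 1 (fun x => cos (b * x)) (- b * sin (b * x)).
  by apply: is_derive_eq; rewrite /GRing.scale/=; ring.
have dsin (x : R) : is_derive x 1 (fun x => sin (b * x)) (b * cos (b * x)).
  by apply: is_derive_eq; rewrite /GRing.scale/=; ring.
apply: prim_C1 => //; apply: continuous_subspaceT => x.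
apply: cvgM; first exact: cvg_cst.
exact: (is_derive_continuous (dcos x)).
Qed.

(** For s < pi the Riccati equation q' = - s^2 - q^2 has a solution
    without poles on [0, 1]; the argument of tan stays within
    (- pi / 2, pi / 2) because it is centred at the midpoint of the interval. *)
Lemma prim_riccati (s : R) : 0 <= s < pi ->
  exists q, prim q (fun x => - s ^+ 2 - q x ^+ 2).
Proof.
move=> /andP[s0 spi].
pose q x := - s * tan (s * x - s / 2).
exists q.
have dq (x : R) : 0 <= x <= 1 -> is_derive x 1 q (- s ^+ 2 - q x ^+ 2).
  move=> /andP[x0 x1].
  have c0 : cos (s * x - s / 2) != 0.
    apply: lt0r_neq0; apply: cos_gt0_pihalf; apply/andP; split; nra.
  have dt := is_derive_tan c0.
  have dl : is_derive x 1 (fun x => s * x - s / 2) s.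
    by apply: is_derive_eq; rewrite /GRing.scale/=; ring.
  have dc := @is_derive1_comp R tan (fun x => s * x - s / 2) x _ _ dt dl.
  rewrite /q; apply: is_derive_eq; rewrite /GRing.scale/=.
  have -> : (cos (s * x - s / 2) ^- 2) = 1 + tan (s * x - s / 2) ^+ 2.
    by rewrite cos2_tan2.
  ring.
apply: prim_C1 => //.
have cq : {within I01, continuous q}.
  apply: derivable_within_continuous => x; rewrite in_itv/= => Ix.
  by have [] := dq x Ix.
have -> : (fun x => - s ^+ 2 - q x ^+ 2) = (fun x => - s ^+ 2 - q x * q x).
  by apply/funext => x; rewrite expr2.
move=> x; apply: cvgB; first exact: cvg_cst.
by apply: cvgM; exact: cq.
Qed.

(** With q from [prim_riccati], f'^2 - s^2 f^2 = (f' - q f)^2 + (q f^2)', and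
    the last term integrates to zero. *)
Lemma wirtinger_lt (s : R) f f' : 0 <= s < pi -> prim f f' -> f 0 = 0 -> f 1 = 0 ->
  s ^+ 2 * int01 (fun x => f x ^+ 2) <= int01 (fun x => f' x ^+ 2).
Proof.
move=> /prim_riccati[q pq] pf f0 f1.
have [_ if'] := pf.1; have [_ if2] := prim_sqint pf.
have pff := primM pf pf.
have := int01_by_parts pq pff; rewrite f0 f1 !mulr0 subrr => E.
rewrite -int01Z// -subr_ge0 -mulN1r -int01Z; last exact: integZ.
rewrite -int01D//; last by apply: integZ; exact: integZ.
have sq : sqint (fun x => f' x + - (q x * f x)).
  have := sqintD pf.1 (sqintZ (-1) (prim_sqint (primM pq pf))).
  by congr sqint; apply/funext => x; ring.
have [_ isq] := sq.
have iq := sqint_integ (primM pq pff).1.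
rewrite (@eq_int01 _ _ (fun x => (f' x + - (q x * f x)) ^+ 2 +
   ((- s ^+ 2 - q x ^+ 2) * (f x * f x) + q x * (f' x * f x + f x * f' x)))); last first.
  by move=> x _; ring.
by rewrite int01D// E addr0; apply: Rintegral_ge0 => x _; exact: sqr_ge0.
Qed.

(** The limit s -> pi in [wirtinger_lt]; at s = pi itself the solution of the
    Riccati equation has poles at both ends. *)
Lemma wirtinger f f' : prim f f' -> f 0 = 0 -> f 1 = 0 ->
  pi ^+ 2 * int01 (fun x => f x ^+ 2) <= int01 (fun x => f' x ^+ 2).
Proof.
move=> pf f0 f1.
have p0 := pi_gt0 R.
have A0 : 0 <= int01 (fun x => f x ^+ 2) by apply: Rintegral_ge0 => x _; exact: sqr_ge0.
have B0 : 0 <= int01 (fun x => f' x ^+ 2) by apply: Rintegral_ge0 => x _; exact: sqr_ge0.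
have h s : 0 <= s < pi -> s ^+ 2 * int01 (fun x => f x ^+ 2) <= int01 (fun x => f' x ^+ 2).
  by move=> hs; exact: wirtinger_lt.
set A := int01 (fun x => f x ^+ 2) in A0 h *.
set B := int01 (fun x => f' x ^+ 2) in B0 h *.
rewrite leNgt; apply/negP => lt.
have Apos : 0 < A.
  rewrite lt_neqAle A0 andbT; apply/eqP => e.
  by move: lt; rewrite -e mulr0 ltNge B0.
(* Were the inequality false, r = sqrt (B / A) would be less than pi, and the
   midpoint of r and pi would contradict [wirtinger_lt]. *)
pose r := Num.sqrt (B / A).
have r2 : r ^+ 2 = B / A by rewrite sqr_sqrtr// divr_ge0.
have r0 : 0 <= r by exact: sqrtr_ge0.
have rA : r ^+ 2 * A = B by rewrite r2 divfK// gt_eqF.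
have rpi : r < pi.
  rewrite ltNge; apply/negP => pr; move: lt; rewrite -rA ltr_pM2r// ltNge.
  by rewrite lerXn2r// nnegrE ltW.
have hs : 0 <= (r + pi) / 2 < pi by lra.
have := h _ hs; rewrite -rA ler_pM2r// => hh; nra.
Qed.

End Wirtinger.

(** * The inner product of complex square-integrable functions *)

Section ComplexL2.
Variable R : realType.
Local Notation cfun := (R -> R[i]^o).
Local Notation mu := (@lebesgue_measure R).
Local Notation I01 := (`[0%R, 1%R]%classic : set R).
Local Notation integ01 f := (mu.-integrable I01 (EFin \o (f : R -> R))).
Local Notation int01 f := (\int[mu]_(x in I01) (f x : R)).
Local Notation toC := (real_complex R).
Local Notation Re := complex.Re.
Local Notation Im := complex.Im.
Local Notation re f := (fun x => Re (f x)).
Local Notation im f := (fun x => Im (f x)).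

Lemma ReD (a b : R[i]) : Re (a + b) = Re a + Re b.
Proof. by case: a; case: b. Qed.
Lemma ImD (a b : R[i]) : Im (a + b) = Im a + Im b.
Proof. by case: a; case: b. Qed.
Lemma ReM (a b : R[i]) : Re (a * b) = Re a * Re b - Im a * Im b.
Proof. by case: a; case: b. Qed.
Lemma ImM (a b : R[i]) : Im (a * b) = Re a * Im b + Im a * Re b.
Proof. by case: a => a1 a2; case: b => b1 b2. Qed.
Lemma ReN (a : R[i]) : Re (- a) = - Re a.
Proof. by case: a. Qed.
Lemma ImN (a : R[i]) : Im (- a) = - Im a.
Proof. by case: a. Qed.
Lemma ReJ (a : R[i]) : Re (conjc a) = Re a.
Proof. by case: a. Qed.
Lemma ImJ (a : R[i]) : Im (conjc a) = - Im a.
Proof. by case: a. Qed.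
Lemma conjcD (a b : R[i]) : conjc (a + b) = conjc a + conjc b.
Proof. exact: rmorphD. Qed.
Lemma conjcM (a b : R[i]) : conjc (a * b) = conjc a * conjc b.
Proof. exact: rmorphM. Qed.
Definition complexEs := (ReD, ImD, ReM, ImM, ReN, ImN, ReJ, ImJ).

Lemma complex_ext (a b : R[i]) : Re a = Re b -> Im a = Im b -> a = b.
Proof. by case: a; case: b => a b c d /= -> ->. Qed.

Lemma L2E (f : cfun) : L2 f <-> sqint (re f) /\ sqint (im f).
Proof.
split=> [[mr mi i]|[[mr ir] [mi ii]]].
- split; split=> //.
  + apply: integ_mono i; first exact: measurable_funX.
    by move=> x _ /=; rewrite ger0_norm ?sqr_ge0// lerDl sqr_ge0.
  + apply: integ_mono i; first exact: measurable_funX.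
    by move=> x _ /=; rewrite ger0_norm ?sqr_ge0// lerDr sqr_ge0.
- by split=> //; exact: integD.
Qed.

Lemma sqint_eq (f g : R -> R) : f =1 g -> sqint f -> sqint g.
Proof. by move=> /funext ->. Qed.

Lemma sqintB (f g : R -> R) : sqint f -> sqint g -> sqint (fun x => f x - g x).
Proof.
by move=> sf sg; apply: sqint_eq (sqintD sf (sqintZ (-1) sg)) => x; rewrite mulN1r.
Qed.

Lemma L2D (f g : cfun) : L2 f -> L2 g -> L2 (f + g).
Proof.
move=> /L2E[fr fi] /L2E[gr gi]; apply/L2E; split.
- by apply: sqint_eq (sqintD fr gr) => x; rewrite -ReD.
- by apply: sqint_eq (sqintD fi gi) => x; rewrite -ImD.
Qed.

Lemma L2Z (c : R[i]) (f : cfun) : L2 f -> L2 (c *: f).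
Proof.
move=> /L2E[fr fi]; apply/L2E; split.
- by apply: sqint_eq (sqintB (sqintZ (Re c) fr) (sqintZ (Im c) fi)) => x; rewrite -ReM.
- by apply: sqint_eq (sqintD (sqintZ (Re c) fi) (sqintZ (Im c) fr)) => x; rewrite -ImM.
Qed.

Lemma L2N (f : cfun) : L2 f -> L2 (- f).
Proof. by rewrite -scaleN1r; exact: L2Z. Qed.

Lemma L2B (f g : cfun) : L2 f -> L2 g -> L2 (f - g).
Proof. by move=> Lf Lg; apply: L2D => //; exact: L2N. Qed.

Lemma L20 : L2 (0 : cfun).
Proof. by apply/L2E; split; exact: sqint_cst. Qed.

(** The form in which integrals of products of real functions are computed. *)
Lemma ipE (f g : cfun) : ip f g =
  Complex (int01 (fun x => Re (f x) * Re (g x) + Im (f x) * Im (g x)))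
          (int01 (fun x => Im (f x) * Re (g x) - Re (f x) * Im (g x))).
Proof.
by congr Complex; apply: eq_int01 => x _; rewrite !complexEs; ring.
Qed.

Section IpIntegrable.
Variables (f g : cfun) (Lf : L2 f) (Lg : L2 g).

Lemma ip_integ_re : integ01 (fun x => Re (f x) * Re (g x) + Im (f x) * Im (g x)).
Proof.
have /L2E[fr fi] := Lf; have /L2E[gr gi] := Lg.
by apply: integD; exact: sqintM.
Qed.

Lemma ip_integ_im : integ01 (fun x => Im (f x) * Re (g x) - Re (f x) * Im (g x)).
Proof.
have /L2E[fr fi] := Lf; have /L2E[gr gi] := Lg.
apply: (integ_eq _ (integD (sqintM fi gr) (integZ (-1) (sqintM fr gi)))).
by move=> x _; rewrite mulN1r.
Qed.

Lemma ip_conj : ip g f = conjc (ip f g).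
Proof.
rewrite !ipE; apply: complex_ext => /=; first by apply: eq_int01 => x _; ring.
rewrite -mulN1r -int01Z; last exact: ip_integ_im.
by apply: eq_int01 => x _; ring.
Qed.

Lemma ipZl (c : R[i]) : ip (c *: f) g = c * ip f g.
Proof.
rewrite !ipE.
apply: complex_ext => /=; rewrite !complexEs /=.
- rewrite -mulNr -!int01Z; [|exact: ip_integ_im|exact: ip_integ_re].
  rewrite -int01D; [|exact: integZ ip_integ_re|exact: integZ ip_integ_im].
  by apply: eq_int01 => x _; rewrite /GRing.scale/= !complexEs; ring.
- rewrite -!int01Z; [|exact: ip_integ_re|exact: ip_integ_im].
  rewrite -int01D; [|exact: integZ ip_integ_im|exact: integZ ip_integ_re].
  by apply: eq_int01 => x _; rewrite /GRing.scale/= !complexEs; ring.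
Qed.

End IpIntegrable.

Lemma ipDl (f g h : cfun) : L2 f -> L2 g -> L2 h -> ip (f + g) h = ip f h + ip g h.
Proof.
move=> Lf Lg Lh; rewrite !ipE; apply: complex_ext => /=.
- rewrite -int01D; [|exact: ip_integ_re|exact: ip_integ_re].
  by apply: eq_int01 => x _; rewrite !complexEs; ring.
- rewrite -int01D; [|exact: ip_integ_im|exact: ip_integ_im].
  by apply: eq_int01 => x _; rewrite !complexEs; ring.
Qed.

Lemma ipDr (f g h : cfun) : L2 f -> L2 g -> L2 h -> ip h (f + g) = ip h f + ip h g.
Proof.
move=> Lf Lg Lh; rewrite (ip_conj (L2D Lf Lg) Lh) ipDl// conjcD.
by rewrite -!ip_conj.
Qed.

Lemma ipZr (c : R[i]) (f g : cfun) : L2 f -> L2 g -> ip g (c *: f) = conjc c * ip g f.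
Proof.
by move=> Lf Lg; rewrite (ip_conj (L2Z c Lf) Lg) ipZl// conjcM -ip_conj.
Qed.

Lemma ipNl (f g : cfun) : L2 f -> L2 g -> ip (- f) g = - ip f g.
Proof. by move=> Lf Lg; rewrite -scaleN1r ipZl// mulN1r. Qed.

Lemma ip0l (g : cfun) : L2 g -> ip 0 g = 0.
Proof. by move=> Lg; rewrite -(scale0r (0 : cfun)) ipZl ?mul0r//; exact: L20. Qed.

Definition nrm2 (f : cfun) : R := int01 (fun x => Re (f x) ^+ 2 + Im (f x) ^+ 2).

Lemma nrm2_ge0 f : 0 <= nrm2 f.
Proof. by apply: Rintegral_ge0 => x _; rewrite addr_ge0 ?sqr_ge0. Qed.

Lemma ip_self f : ip f f = toC (nrm2 f).
Proof.
rewrite ipE; apply: complex_ext => /=; first by apply: eq_int01 => x _; rewrite !expr2.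
transitivity (int01 (fun=> 0)); last by rewrite int01_cst.
by apply: eq_int01 => x _; ring.
Qed.

Lemma nrm2D f g : L2 f -> L2 g ->
  nrm2 (f + g) = nrm2 f + 2 * Re (ip f g) + nrm2 g.
Proof.
move=> Lf Lg; have := ip_self (f + g); rewrite ipDl ?ipDr//; try exact: L2D.
rewrite !ip_self (ip_conj Lf Lg) => /(congr1 (@complex.Re R)).
by rewrite !ReD ReJ/= => <-; ring.
Qed.

Lemma nrm2Z (c : R[i]) f : L2 f -> nrm2 (c *: f) = (Re c ^+ 2 + Im c ^+ 2) * nrm2 f.
Proof.
move=> Lf; have := ip_self (c *: f); rewrite ipZl ?ipZr//; last exact: L2Z.
by rewrite ip_self => /(congr1 (@complex.Re R)); rewrite !complexEs/= => <-; ring.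
Qed.

(** The squared norm of f - s <f, g> g is a nonnegative quadratic polynomial
    in the real number s.  The values of s chosen below minimize it when g is
    not null, and make it negative when g is null but <f, g> is not zero. *)
Lemma cauchy_schwarz f g : L2 f -> L2 g ->
  Re (ip f g) ^+ 2 + Im (ip f g) ^+ 2 <= nrm2 f * nrm2 g.
Proof.
move=> Lf Lg.
have h s : 0 <= nrm2 f - 2 * s * (Re (ip f g) ^+ 2 + Im (ip f g) ^+ 2)
   + s ^+ 2 * (Re (ip f g) ^+ 2 + Im (ip f g) ^+ 2) * nrm2 g.
  have := nrm2_ge0 (f + (- (toC s * ip f g)) *: g).
  rewrite nrm2D//; last exact: L2Z.
  rewrite nrm2Z// ipZr//; move: (ip f g) => p; rewrite !complexEs/= => H.
  by lra.
move: (nrm2_ge0 f) (nrm2_ge0 g) h.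
have : 0 <= Re (ip f g) ^+ 2 + Im (ip f g) ^+ 2 by rewrite addr_ge0 ?sqr_ge0.
move: (_ + _) (nrm2 f) (nrm2 g) => P A B P0 A0 B0 h.
have [->|Pn] := eqVneq P 0; first exact: mulr_ge0.
have {P0} P0 : 0 < P by rewrite lt_neqAle eq_sym Pn.
have [B00|Bn] := eqVneq B 0.
  have := h ((A + 1) / (2 * P)); rewrite B00 mulr0 addr0.
  have -> : 2 * ((A + 1) / (2 * P)) * P = A + 1 by field; rewrite Pn.
  lra.
have {B0} B0 : 0 < B by rewrite lt_neqAle eq_sym Bn.
have := h B^-1.
have -> : A - 2 * B^-1 * P + B^-1 ^+ 2 * P * B = A - P / B by field.
by rewrite subr_ge0 ler_pdivrMr.
Qed.

End ComplexL2.

(** * Sobolev functions with Dirichlet conditions *)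

Section Sobolev.
Variable R : realType.
Local Notation cfun := (R -> R[i]^o).
Local Notation mu := (@lebesgue_measure R).
Local Notation I01 := (`[0%R, 1%R]%classic : set R).
Local Notation integ01 f := (mu.-integrable I01 (EFin \o (f : R -> R))).
Local Notation int01 f := (\int[mu]_(x in I01) (f x : R)).
Local Notation Re := complex.Re.
Local Notation Im := complex.Im.
Local Notation re f := (fun x => Re (f x)).
Local Notation im f := (fun x => Im (f x)).

(** On [0, x] the function f^2 varies by the integral of 2 f f', at most
    int (f^2 / s + s f'^2) = s int f'^2 for every s > 0.  So f^2 is constant,
    and its value is its integral. *)
Lemma prim_zero (f g : R -> R) : prim f g -> int01 (fun x => f x ^+ 2) = 0 ->
  forall x, 0 <= x <= 1 -> f x = 0.
Proof.
move=> pf f0.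
have [_ i2f] := prim_sqint pf; have [sg _] := pf; have [_ i2g] := sg.
have [sff ff] := primM pf pf.
pose B := int01 (fun x => g x ^+ 2).
have bnd x s : 0 <= x <= 1 -> 0 < s -> `|f x * f x - f 0 * f 0| <= s * B.
  move=> Ix s0; rewrite (ff x)// addrC addKr.
  have idom : integ01 (fun t => s^-1 * f t ^+ 2 + s * g t ^+ 2).
    by apply: integD; exact: integZ.
  have imain := sqint_integ sff.
  have x1 : x <= 1 by case/andP : Ix.
  apply: le_trans (le_normr_Rintegral _ _) _ => //; first exact: integ_sub.
  have -> : s * B = int01 (fun t => s^-1 * f t ^+ 2 + s * g t ^+ 2).
    by rewrite int01D; [rewrite !int01Z// f0 mulr0 add0r|exact: integZ|exact: integZ].
  rewrite Rintegral_mkcond [leRHS]Rintegral_mkcond; apply: le_Rintegral => //.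
  - rewrite -restrict_EFin; apply/integrable_restrict => //=; rewrite setTI.
    by apply: integrable_norm; exact: integ_sub.
  - by rewrite -restrict_EFin; apply/integrable_restrict => //=; rewrite setTI.
  - move=> t _; rewrite !patchE.
    have dom0 : `|g t * f t + f t * g t| <= s^-1 * f t ^+ 2 + s * g t ^+ 2.
      have e : s^-1 * f t ^+ 2 + s * g t ^+ 2 - 2 * `|f t * g t| =
          s^-1 * (`|f t| - s * `|g t|) ^+ 2.
        rewrite normrM -(real_normK (num_real (f t))) -(real_normK (num_real (g t))).
        by field; rewrite gt_eqF.
      have -> : g t * f t + f t * g t = 2 * (f t * g t) by ring.
      rewrite normrM ger0_norm// -subr_ge0 e mulr_ge0 ?sqr_ge0// invr_ge0 ltW//.
    case: ifPn => [/set_mem tx|_].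
      by rewrite mem_set//; exact: I0x_sub tx.
    by case: ifPn => // _; exact: le_trans (normr_ge0 _) dom0.
have sqc x : 0 <= x <= 1 -> f x ^+ 2 = f 0 ^+ 2.
  move=> Ix; rewrite !expr2; apply/eqP; rewrite -subr_eq0 -normr_eq0.
  rewrite eq_le normr_ge0 andbT; apply/ler_addgt0Pr => e e0; rewrite add0r.
  have B0 : 0 <= B by apply: Rintegral_ge0 => t _; exact: sqr_ge0.
  have B1 : 0 < B + 1 by rewrite ltr_wpDl.
  apply: le_trans (bnd x (e / (B + 1)) Ix _) _; first exact: divr_gt0.
  by rewrite mulrAC ler_pdivrMr// ler_pM2l// lerDl.
have f00 : f 0 ^+ 2 = 0.
  transitivity (int01 (fun x => f x ^+ 2)); last exact: f0.
  rewrite -[LHS]int01_cst; apply: eq_int01 => x; rewrite /= in_itv/= => Ix.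
  by rewrite (sqc x).
by move=> x Ix; apply/eqP; rewrite -sqrf_eq0 sqc// f00.
Qed.

Lemma is_derivE (f g : cfun) :
  is_deriv f g <-> prim (re f) (re g) /\ prim (im f) (im g).
Proof.
split=> [[/L2E[sr si] fg]|[[sr fr] [si fi]]].
- by split; split=> // x Ix; rewrite (fg x)// ?ReD ?ImD.
- split; first exact/L2E.
  by move=> x Ix; apply: complex_ext; rewrite !complexEs/= ?(fr x)// ?(fi x).
Qed.

Lemma is_deriv_L2 (f g : cfun) : is_deriv f g -> L2 f.
Proof. by move=> /is_derivE[/prim_sqint pr /prim_sqint pi]; exact/L2E. Qed.

Lemma prim_eq (f f' g g' : R -> R) : (forall x, 0 <= x <= 1 -> f x = f' x) -> g =1 g' ->
  prim f g -> prim f' g'.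
Proof.
move=> ff' /funext -> [sg fg]; split=> // x Ix.
by rewrite -!ff' ?lexx ?ler01// (fg x).
Qed.

Lemma primB (f g u v : R -> R) : prim f g -> prim u v ->
  prim (fun x => f x - u x) (fun x => g x - v x).
Proof.
by move=> pf pu; apply: prim_eq (primD pf (primZ (-1) pu)) => x *; rewrite mulN1r.
Qed.

Lemma is_deriv_eq (f f' g : cfun) : (forall x, 0 <= x <= 1 -> f x = f' x) ->
  is_deriv f g -> is_deriv f' g.
Proof.
move=> ff' [Lg fg]; split=> // x Ix.
by rewrite -!ff' ?lexx ?ler01// (fg x).
Qed.

Lemma is_deriv_cst (c : R[i]) : is_deriv (fun=> c : R[i]^o) 0.
Proof. by apply/is_derivE; split; exact: prim_cst. Qed.

Lemma is_derivD (f g u v : cfun) : is_deriv f g -> is_deriv u v ->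
  is_deriv (f + u) (g + v).
Proof.
move=> /is_derivE[fr fi] /is_derivE[ur ui]; apply/is_derivE; split.
- by apply: prim_eq (primD fr ur) => x *; rewrite -ReD.
- by apply: prim_eq (primD fi ui) => x *; rewrite -ImD.
Qed.

Lemma is_derivZ (c : R[i]) (f g : cfun) : is_deriv f g -> is_deriv (c *: f) (c *: g).
Proof.
move=> /is_derivE[fr fi]; apply/is_derivE; split.
- apply: prim_eq (primB (primZ (Re c) fr) (primZ (Im c) fi)) => x *;
    by rewrite -ReM.
- apply: prim_eq (primD (primZ (Re c) fi) (primZ (Im c) fr)) => x *;
    by rewrite -ImM.
Qed.

Lemma is_derivM (f g u v : cfun) : is_deriv f g -> is_deriv u v ->
  is_deriv (fun x => (f x : R[i]) * u x) (fun x => (g x : R[i]) * u x + (f x : R[i]) * v x).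
Proof.
move=> /is_derivE[fr fi] /is_derivE[ur ui]; apply/is_derivE; split.
- apply: prim_eq (primB (primM fr ur) (primM fi ui)) => x *; rewrite !complexEs//; ring.
- apply: prim_eq (primD (primM fr ui) (primM fi ur)) => x *; rewrite !complexEs//; ring.
Qed.

Lemma ip_by_parts (f g u v : cfun) : is_deriv f g -> is_deriv u v ->
  ip g u + ip f v = (f 1 : R[i]) * conjc (u 1) - (f 0 : R[i]) * conjc (u 0).
Proof.
move=> df du; have Lf := is_deriv_L2 df; have Lu := is_deriv_L2 du.
have [Lg _] := df; have [Lv _] := du.
have /is_derivE[fr fi] := df; have /is_derivE[ur ui] := du.
have rr := int01_by_parts fr ur; have ii := int01_by_parts fi ui.
have ri := int01_by_parts fr ui; have ir := int01_by_parts fi ur.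
have irr := sqint_integ (primM fr ur).1; have iii := sqint_integ (primM fi ui).1.
have iri := sqint_integ (primM fr ui).1; have iir := sqint_integ (primM fi ur).1.
rewrite !ipE; apply: complex_ext; rewrite !complexEs/=.
- rewrite -int01D; [|exact: ip_integ_re|exact: ip_integ_re].
  transitivity (int01 (fun x => (Re (g x) * Re (u x) + Re (f x) * Re (v x)) +
     (Im (g x) * Im (u x) + Im (f x) * Im (v x)))).
    by apply: eq_int01 => x _; ring.
  by rewrite int01D// rr ii; ring.
- rewrite -int01D; [|exact: ip_integ_im|exact: ip_integ_im].
  transitivity (int01 (fun x => (Im (g x) * Re (u x) + Im (f x) * Re (v x)) +
     (- 1) * (Re (g x) * Im (u x) + Re (f x) * Im (v x)))).
    by apply: eq_int01 => x _; ring.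
  by rewrite int01D//; [rewrite int01Z// ri ir; ring|exact: integZ].
Qed.

Lemma is_deriv_unique (f g g' : cfun) : is_deriv f g -> is_deriv f g' ->
  nrm2 (g - g') = 0.
Proof.
move=> /is_derivE[r i] /is_derivE[r' i'].
rewrite /nrm2 int01D.
- have e1 := prim_unique r r'; have e2 := prim_unique i i'.
  have -> : int01 (fun x => Re ((g - g') x) ^+ 2) = 0.
    by rewrite -[RHS]e1; apply: eq_int01 => x _; rewrite !complexEs.
  rewrite add0r -[RHS]e2; apply: eq_int01 => x _; by rewrite !complexEs.
- have [_] := sqintB r.1 r'.1; apply: integ_eq => x _; by rewrite !complexEs.
- have [_] := sqintB i.1 i'.1; apply: integ_eq => x _; by rewrite !complexEs.
Qed.

Lemma is_deriv_zero (f g : cfun) : is_deriv f g -> nrm2 f = 0 ->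
  forall x, 0 <= x <= 1 -> f x = 0.
Proof.
move=> /is_derivE[r i] f0 x Ix.
have [_ ir] := prim_sqint r; have [_ ii] := prim_sqint i.
have r0 : 0 <= int01 (fun x => Re (f x) ^+ 2) by apply: Rintegral_ge0 => t _; exact: sqr_ge0.
have i0 : 0 <= int01 (fun x => Im (f x) ^+ 2) by apply: Rintegral_ge0 => t _; exact: sqr_ge0.
move: f0; rewrite /nrm2 int01D// => /eqP; rewrite paddr_eq0// => /andP[/eqP e1 /eqP e2].
by apply: complex_ext; rewrite /= ?(prim_zero r)// ?(prim_zero i).
Qed.

(** Null functions can be ignored in inner products; this makes the choice of
    representatives of second derivatives immaterial. *)
Lemma ip_null_l (f g : cfun) : L2 f -> L2 g -> nrm2 f = 0 -> ip f g = 0.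
Proof.
move=> Lf Lg f0; have := cauchy_schwarz Lf Lg; rewrite f0 mul0r.
move: (ip f g) => [a b] /= h.
have : a ^+ 2 + b ^+ 2 == 0 by rewrite eq_le h addr_ge0 ?sqr_ge0.
by rewrite paddr_eq0 ?sqr_ge0// !sqrf_eq0 => /andP[/eqP -> /eqP ->].
Qed.

Lemma ip_eql (f f' g : cfun) : L2 f -> L2 f' -> L2 g -> nrm2 (f - f') = 0 ->
  ip f g = ip f' g.
Proof.
move=> Lf Lf' Lg e; rewrite -[f in LHS](subrK f') ipDl//; last exact: L2B.
by rewrite ip_null_l ?add0r//; exact: L2B.
Qed.

Lemma ip_eqr (f f' g : cfun) : L2 f -> L2 f' -> L2 g -> nrm2 (f - f') = 0 ->
  ip g f = ip g f'.
Proof.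
by move=> Lf Lf' Lg e; rewrite (ip_conj Lf Lg) (ip_eql Lf Lf') -?ip_conj.
Qed.

Lemma H2P (z : cfun) : H2 z -> is_derivs z (d1 z, d2 z).
Proof.
by move=> hz; rewrite /d1 /d2 -surjective_pairing /derivs; exact: xgetPex.
Qed.

(** First derivatives are absolutely continuous, hence agree everywhere once
    they agree almost everywhere. *)
Lemma d2_unique (z p q : cfun) : is_derivs z (p, q) ->
  (forall x, 0 <= x <= 1 -> d1 z x = p x) /\ nrm2 (d2 z - q) = 0.
Proof.
move=> h; have [/= zp pq] := h.
have [/= zd dd] : is_derivs z (d1 z, d2 z) by apply: H2P; exists (p, q).
have e x : 0 <= x <= 1 -> d1 z x = p x.
  move=> Ix; apply/eqP; rewrite -subr_eq0 -scaleN1r; apply/eqP.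
  have := @is_deriv_zero (d1 z + (-1) *: p) _ (is_derivD dd (is_derivZ (-1) pq)) _ x Ix.
  apply; rewrite scaleN1r; exact: is_deriv_unique zd zp.
split => //; apply: is_deriv_unique dd _.
by apply: is_deriv_eq pq => x Ix; rewrite e.
Qed.

(** Derivatives are carried along explicitly: [d1] and [d2] are arbitrary
    choices, so they need not commute with linear combinations. *)
Definition dirichlet (z p q : cfun) :=
  [/\ is_deriv z p, is_deriv p q, z 0 = 0 & z 1 = 0].

Lemma HhalfP (z : cfun) : Hhalf z -> dirichlet z (d1 z) (d2 z).
Proof. by move=> [/H2P[zd dd] z0 z1]; split. Qed.

Lemma dirichlet_Hhalf (z p q : cfun) : dirichlet z p q -> Hhalf z.
Proof. by move=> [zp pq z0 z1]; split=> //; exists (p, q). Qed.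

Lemma dirichletD (z p q z' p' q' : cfun) : dirichlet z p q -> dirichlet z' p' q' ->
  dirichlet (z + z') (p + p') (q + q').
Proof.
move=> [a b c d] [a' b' c' d']; split; try exact: is_derivD.
- by rewrite -[LHS]/(z 0 + z' 0) c c' addr0.
- by rewrite -[LHS]/(z 1 + z' 1) d d' addr0.
Qed.

Lemma dirichletZ (c : R[i]) (z p q : cfun) : dirichlet z p q ->
  dirichlet (c *: z) (c *: p) (c *: q).
Proof.
move=> [a b e d]; split; try exact: is_derivZ.
- by rewrite -[LHS]/(c *: z 0) e scaler0.
- by rewrite -[LHS]/(c *: z 1) d scaler0.
Qed.

Section Poincare.
Variables (z p q : cfun) (hz : dirichlet z p q).

Lemma dirichlet_L2 : [/\ L2 z, L2 p & L2 q].
Proof. by have [a b _ _] := hz; split; [exact: is_deriv_L2 a|exact: is_deriv_L2 b|case: b]. Qed.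

Lemma dirichlet_skew : ip p z + ip z p = 0.
Proof. by have [a _ c d] := hz; rewrite (ip_by_parts a a) c d !mul0r subrr. Qed.

Lemma dirichlet_parts : ip q z + ip p p = 0.
Proof. by have [a b c d] := hz; rewrite (ip_by_parts b a) c d conjc0 !mulr0 subrr. Qed.

Lemma poincare1 : pi ^+ 2 * nrm2 z <= nrm2 p.
Proof.
have [/is_derivE[r i] _ c d] := hz.
have [_ i1] := prim_sqint r; have [_ i2] := prim_sqint i.
have [_ i3] := r.1; have [_ i4] := i.1.
rewrite /nrm2 !int01D// mulrDr; apply: lerD.
- by apply: wirtinger r _ _; rewrite ?c ?d.
- by apply: wirtinger i _ _; rewrite ?c ?d.
Qed.

(** Integration by parts gives |z'|^2 = - <z'', z> <= |z''| |z|, and |z| is at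
    most |z'| / pi. *)
Lemma poincare2 : pi ^+ 2 * nrm2 p <= nrm2 q.
Proof.
have [Lz Lp Lq] := dirichlet_L2.
have e : nrm2 p = - Re (ip q z).
  have /(congr1 (@complex.Re R)) := dirichlet_parts.
  by rewrite ReD ip_self/= => h; lra.
have cs := cauchy_schwarz Lq Lz.
have := poincare1; have := nrm2_ge0 z; have := nrm2_ge0 p; have := nrm2_ge0 q.
have p2 : 0 < (pi : R) ^+ 2 by rewrite exprn_gt0// pi_gt0.
have : nrm2 p ^+ 2 <= nrm2 q * nrm2 z.
  by apply: le_trans cs; rewrite e sqrrN lerDl sqr_ge0.
move: (nrm2 p) (nrm2 q) (nrm2 z) p2 => P Q Z; move: (pi ^+ 2) => k k0 h Q0 P0 Z0 kz.
have [->|Pn] := eqVneq P 0; first by rewrite mulr0.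
have Pp : 0 < P by rewrite lt_neqAle eq_sym Pn.
rewrite -(ler_pM2r Pp) -mulrA -expr2; nra.
Qed.

Lemma poincare : pi ^+ 4 * nrm2 z <= nrm2 q.
Proof.
have := poincare1; have := poincare2; have p2 : 0 <= (pi : R) ^+ 2 by rewrite sqr_ge0.
have -> : (pi : R) ^+ 4 = pi ^+ 2 * pi ^+ 2 by rewrite -exprD.
move: (pi ^+ 2) p2 => k k0 h1 h2; apply: le_trans h1.
by rewrite -mulrA ler_wpM2l.
Qed.

(** Integration by parts gives <z', z> + <z, z'> = 0; the bound combines
    Cauchy-Schwarz with the two Poincare inequalities. *)
Lemma dirichlet_im : Re (ip p z) = 0 /\ pi ^+ 3 * `|Im (ip p z)| <= nrm2 q.
Proof.
have [Lz Lp Lq] := dirichlet_L2.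
have e : Re (ip p z) = 0.
  have := dirichlet_skew; rewrite (ip_conj Lp Lz) => /(congr1 (@complex.Re R)).
  rewrite ReD ReJ/= => h; lra.
split => //; have := cauchy_schwarz Lp Lz; rewrite e expr0n/= add0r => cs.
have p0 := pi_gt0 R.
rewrite -(@ler_pXn2r _ 2)// ?nnegrE ?nrm2_ge0 ?mulr_ge0 ?exprn_ge0 ?(ltW p0)//.
rewrite exprMn real_normK ?num_real//.
apply: le_trans (_ : (pi ^+ 3) ^+ 2 * (nrm2 p * nrm2 z) <= _).
  by rewrite ler_wpM2l// sqr_ge0.
have -> : (pi ^+ 3) ^+ 2 * (nrm2 p * nrm2 z) = (pi ^+ 2 * nrm2 p) * (pi ^+ 4 * nrm2 z) by ring.
rewrite [leRHS]expr2; apply: ler_pM; [| |exact: poincare2|exact: poincare];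
  by rewrite mulr_ge0 ?nrm2_ge0 ?exprn_ge0 ?(ltW p0).
Qed.

End Poincare.
End Sobolev.

(** * A fourth-order boundary value problem with constant coefficients *)

Section BoundaryValueProblem.
Variable R : realType.
Local Notation cfun := (R -> R[i]^o).
Local Notation Re := complex.Re.
Local Notation Im := complex.Im.

Definition cexp (r : R[i]) : cfun := fun x =>
  Complex (expR (Re r * x) * cos (Im r * x)) (expR (Re r * x) * sin (Im r * x)).

Lemma is_deriv_cexp (r : R[i]) : is_deriv (cexp r) (r *: cexp r).
Proof.
have e := prim_exp (Re r); have c := prim_cos (Im r); have s := prim_sin (Im r).
apply/is_derivE; split.
- apply: prim_eq (primM e c) => x *; rewrite //= /GRing.scale/= ReM /cexp/=; ring.
- apply: prim_eq (primM e s) => x *; rewrite //= /GRing.scale/= ImM /cexp/=; ring.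
Qed.

Lemma cexpN (r : R[i]) x : (cexp r x : R[i]) * cexp (- r) x = 1.
Proof.
have h := cos2Dsin2 (Im r * x).
apply: complex_ext; rewrite !complexEs/= !(ReN, ImN) !mulNr expRN cosN sinN.
- have e0 : expR (Re r * x) != 0 by rewrite gt_eqF// expR_gt0.
  rewrite -[RHS]h; field; exact: e0.
- ring.
Qed.

Lemma L2M (f g u : cfun) : is_deriv f g -> L2 u -> L2 (fun x => (f x : R[i]) * u x).
Proof.
move=> /is_derivE[r i] /L2E[ur ui]; apply/L2E.
have [Mr hr] := cont_bounded (prim_continuous r).
have [Mi hi] := cont_bounded (prim_continuous i).
have mr := cont_measurable (prim_continuous r).
have mi := cont_measurable (prim_continuous i).
split.
- apply: sqint_eq (sqintB (sqint_mulb mr hr ur) (sqint_mulb mi hi ui)) => x.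
  by rewrite -ReM.
- apply: sqint_eq (sqintD (sqint_mulb mr hr ui) (sqint_mulb mi hi ur)) => x.
  by rewrite -ImM.
Qed.

Lemma cintegral_point (f : R -> R[i]) : cintegral (`[0%R, 0%R]%classic : set R) f = 0.
Proof. by rewrite /cintegral set_itv1 !Rintegral_set1. Qed.

(** Variation of constants: y(x) = e^(r x) (c + int_0^x e^(- r u) G(u) du). *)
Lemma first_order (r c : R[i]) (G : cfun) : L2 G ->
  exists y, is_deriv y (r *: y + G) /\ y 0 = c.
Proof.
move=> LG; pose H : cfun := fun x => (cexp (- r) x : R[i]) * G x.
have LH : L2 H := L2M (is_deriv_cexp (- r)) LG.
pose P : cfun := fun x => c + cintegral (`[0%R, x]%classic) H.
have P0 : P 0 = c by rewrite /P cintegral_point addr0.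
have dP : is_deriv P H by split=> // x Ix; rewrite P0.
exists (fun x => (cexp r x : R[i]) * P x); split; last first.
  by rewrite P0 /cexp !mulr0 expR0 cos0 sin0 !mul1r.
have := is_derivM (is_deriv_cexp r) dP; congr is_deriv; apply/funext => x.
have E : (cexp r x : R[i]) * H x = G x by rewrite /H mulrA cexpN mul1r.
transitivity ((r * (cexp r x : R[i])) * P x + G x : R[i]); first by rewrite -[in RHS]E.
by rewrite -mulrA.
Qed.

(** The equation (D - r1) (D - r2) (D - r3) (D - r4) y4 = G, with
    y3 = (D - r4) y4, y2 = (D - r3) y3 and y1 = (D - r2) y2. *)
Definition cascade (r1 r2 r3 r4 : R[i]) (G y1 y2 y3 y4 : cfun) :=
  [/\ is_deriv y1 (r1 *: y1 + G), is_deriv y2 (r2 *: y2 + y1),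
      is_deriv y3 (r3 *: y3 + y2) & is_deriv y4 (r4 *: y4 + y3)].

(** The second derivative of y4 in a cascade. *)
Definition second (r3 r4 : R[i]) (y2 y3 y4 : cfun) : cfun :=
  r4 *: (r4 *: y4 + y3) + (r3 *: y3 + y2).

Section Cascade.
Variables r1 r2 r3 r4 : R[i].

Lemma cascade_exists (G : cfun) (c1 c2 c3 c4 : R[i]) : L2 G ->
  exists y1 y2 y3 y4, cascade r1 r2 r3 r4 G y1 y2 y3 y4 /\
   [/\ y1 0 = c1, y2 0 = c2, y3 0 = c3 & y4 0 = c4].
Proof.
move=> LG; have [y1 [h1 e1]] := first_order r1 c1 LG.
have [y2 [h2 e2]] := first_order r2 c2 (is_deriv_L2 h1).
have [y3 [h3 e3]] := first_order r3 c3 (is_deriv_L2 h2).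
have [y4 [h4 e4]] := first_order r4 c4 (is_deriv_L2 h3).
by exists y1, y2, y3, y4.
Qed.

Lemma cascadeD G G' y1 y2 y3 y4 y1' y2' y3' y4' (a : R[i]) :
  cascade r1 r2 r3 r4 G y1 y2 y3 y4 -> cascade r1 r2 r3 r4 G' y1' y2' y3' y4' ->
  cascade r1 r2 r3 r4 (G + a *: G') (y1 + a *: y1') (y2 + a *: y2')
    (y3 + a *: y3') (y4 + a *: y4').
Proof.
have step r (y g y' g' : cfun) : is_deriv y (r *: y + g) -> is_deriv y' (r *: y' + g') ->
    is_deriv (y + a *: y') (r *: (y + a *: y') + (g + a *: g')).
  move=> h h'; have := is_derivD h (is_derivZ a h'); congr is_deriv.
  by rewrite !scalerDr !scalerA (mulrC a r) addrACA.
by move=> [? ? ? ?] [? ? ? ?]; split; exact: step.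
Qed.

Lemma cascade_sum G y1 y2 y3 y4 n (c : 'I_n -> R[i]) (u1 u2 u3 u4 : 'I_n -> cfun) :
  cascade r1 r2 r3 r4 G y1 y2 y3 y4 ->
  (forall j, cascade r1 r2 r3 r4 0 (u1 j) (u2 j) (u3 j) (u4 j)) ->
  cascade r1 r2 r3 r4 G (y1 + \sum_j c j *: u1 j) (y2 + \sum_j c j *: u2 j)
    (y3 + \sum_j c j *: u3 j) (y4 + \sum_j c j *: u4 j).
Proof.
move=> hy hu; elim: n c u1 u2 u3 u4 hu => [|n IH] c u1 u2 u3 u4 hu.
  by rewrite !big_ord0 !addr0.
rewrite !big_ord_recr/= !addrA.
have := cascadeD (c ord_max) (IH _ _ _ _ _ (fun j => hu (widen_ord (leqnSn n) j))) (hu ord_max).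
by move=> /(_ (fun j => c (widen_ord (leqnSn n) j))); rewrite scaler0 addr0.
Qed.

(** If y = 0 on [0, 1], then both r y + g and 0 are derivatives of y.  Used to
    climb a cascade from y4 up to y1. *)
Lemma cascade_zero (r : R[i]) (y g g' : cfun) : is_deriv y (r *: y + g) -> is_deriv g g' ->
  (forall x, 0 <= x <= 1 -> y x = 0) -> forall x, 0 <= x <= 1 -> g x = 0.
Proof.
move=> hy hg y0 x Ix.
have d0 : is_deriv y 0 by apply: is_deriv_eq (is_deriv_cst 0) => t It; rewrite y0.
have n0 := is_deriv_unique hy d0; rewrite subr0 in n0.
have := is_deriv_zero (is_derivD (is_derivZ r hy) hg) n0 Ix.
rewrite -[LHS]/(r *: y x + g x) y0//.
by rewrite scaler0 add0r.
Qed.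

End Cascade.

(** The complex numbers are algebraically closed; the equations are the Vieta
    relations of X^4 + a X + b. *)
Lemma quartic_factor (a b : R[i]) : exists r1 r2 r3 r4 : R[i],
  [/\ r1 + r2 + r3 + r4 = 0,
      r1 * r2 + r1 * r3 + r1 * r4 + r2 * r3 + r2 * r4 + r3 * r4 = 0,
      - (r1 * r2 * r3 + r1 * r2 * r4 + r1 * r3 * r4 + r2 * r3 * r4) = a &
      r1 * r2 * r3 * r4 = b].
Proof.
pose p : {poly R[i]} := 'X^4 + (a%:P * 'X + b%:P).
have sz : (size ((a%:P * 'X + b%:P)%R : {poly R[i]}) < 5)%N.
  rewrite (leq_ltn_trans (size_polyD _ _))// gtn_max !ltnS (leq_trans (size_polyC_leq1 _))// andbT.
  rewrite (leq_trans (size_polyMleq _ _))// size_polyX addn2/= ltnS.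
  by rewrite (leq_trans (size_polyC_leq1 _)).
have szp : size p = 5%N by rewrite /p size_polyDl size_polyXn.
have lc : lead_coef p = 1 by rewrite /p lead_coefDl ?lead_coefXn// size_polyXn.
have [rs] := closed_field_poly_normal p; rewrite lc scale1r => E.
have : size rs = 4%N by apply/eqP; rewrite -eqSS -(size_prod_XsubC rs id) -E szp.
case: rs E => [|r1 [|r2 [|r3 [|r4 [|]]]]]//; rewrite !big_cons big_nil mulr1 => E _.
exists r1, r2, r3, r4.
have {}E : p = 'X^4 + ((- (r1 + r2 + r3 + r4))%:P * 'X^3 +
  ((r1 * r2 + r1 * r3 + r1 * r4 + r2 * r3 + r2 * r4 + r3 * r4)%:P * 'X^2 +
  ((- (r1 * r2 * r3 + r1 * r2 * r4 + r1 * r3 * r4 + r2 * r3 * r4))%:P * 'X +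
   (r1 * r2 * r3 * r4)%:P))).
  by rewrite E !(polyCD, polyCN, polyCM); ring.
have c i := congr1 (fun p : {poly R[i]} => p`_i) E.
split.
- by have := c 3%N; rewrite /p !(coefD, coefXn, coefCM, coefX, coefC)/=
    !(mulr0, mulr1, addr0, add0r) => /eqP; rewrite eq_sym oppr_eq0 => /eqP.
- by have := c 2%N; rewrite /p !(coefD, coefXn, coefCM, coefX, coefC)/=
    !(mulr0, mulr1, addr0, add0r).
- by have := c 1%N; rewrite /p !(coefD, coefXn, coefCM, coefX, coefC)/=
    !(mulr0, mulr1, addr0, add0r).
- by have := c 0%N; rewrite /p !(coefD, coefXn, coefCM, coefX, coefC)/=
    !(mulr0, mulr1, addr0, add0r).
Qed.

Definition quartic_bvp (a b : R[i]) (G z p q s t : cfun) :=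
  [/\ dirichlet z p q, dirichlet q s t & t = G - a *: p - b *: z].

Section Cascade2.
Variables (a b r1 r2 r3 r4 : R[i]).
Hypothesis (e1 : r1 + r2 + r3 + r4 = 0)
  (e2 : r1 * r2 + r1 * r3 + r1 * r4 + r2 * r3 + r2 * r4 + r3 * r4 = 0)
  (e3 : - (r1 * r2 * r3 + r1 * r2 * r4 + r1 * r3 * r4 + r2 * r3 * r4) = a)
  (e4 : r1 * r2 * r3 * r4 = b).

(** The hypotheses on the roots say that D^4 + a D + b factors as in
    [cascade]. *)
Lemma cascade_bvp G y1 y2 y3 y4 : cascade r1 r2 r3 r4 G y1 y2 y3 y4 ->
  y4 0 = 0 -> y4 1 = 0 -> second r3 r4 y2 y3 y4 0 = 0 -> second r3 r4 y2 y3 y4 1 = 0 ->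
  exists p q s t, quartic_bvp a b G y4 p q s t.
Proof.
move=> [h1 h2 h3 h4] b1 b2 b3 b4.
have d1 := is_derivD (is_derivZ r4 h4) h3.
have d3' := is_derivD (is_derivZ r3 h3) h2.
have d2 := is_derivD (is_derivZ r4 d1) d3'.
have d2' := is_derivD (is_derivZ r2 h2) h1.
have d3'' := is_derivD (is_derivZ r3 d3') d2'.
have d3 := is_derivD (is_derivZ r4 d2) d3''.
pose p := r4 *: y4 + y3; pose q := second r3 r4 y2 y3 y4.
pose v := r3 *: (r3 *: y3 + y2) + (r2 *: y2 + y1).
pose s := r4 *: q + v.
pose t := r4 *: s + (r3 *: v + (r2 *: (r2 *: y2 + y1) + (r1 *: y1 + G))).
exists p, q, s, t; split; [by split|by split|].
have -> : t = G + (r1 + r2 + r3 + r4) *: s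
  - (r1 * r2 + r1 * r3 + r1 * r4 + r2 * r3 + r2 * r4 + r3 * r4) *: q
  + (r1 * r2 * r3 + r1 * r2 * r4 + r1 * r3 * r4 + r2 * r3 * r4) *: p
  - (r1 * r2 * r3 * r4) *: y4.
  have key (u1 u2 u3 u4 g : R[i]) :
      let p := r4 * u4 + u3 in let q := r4 * p + (r3 * u3 + u2) in
      let v := r3 * (r3 * u3 + u2) + (r2 * u2 + u1) in let s := r4 * q + v in
      r4 * s + (r3 * v + (r2 * (r2 * u2 + u1) + (r1 * u1 + g))) =
      g + (r1 + r2 + r3 + r4) * s
      - (r1 * r2 + r1 * r3 + r1 * r4 + r2 * r3 + r2 * r4 + r3 * r4) * q
      + (r1 * r2 * r3 + r1 * r2 * r4 + r1 * r3 * r4 + r2 * r3 * r4) * p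
      - (r1 * r2 * r3 * r4) * u4 by move=> /=; ring.
  by apply/funext => x; exact: key (y1 x) (y2 x) (y3 x) (y4 x) (G x).
by rewrite e1 e2 e4 -e3 !scale0r subr0 addr0 scaleNr opprK.
Qed.

End Cascade2.

End BoundaryValueProblem.

Section BvpExistence.
Variable R : realType.
Local Notation cfun := (R -> R[i]^o).

Lemma fct_lincomb n (c : 'I_n -> R[i]) (y : cfun) (u : 'I_n -> cfun) (x : R) :
  (y + \sum_j c j *: u j) x = y x + \sum_j c j * (u j x : R[i]) :> R[i].
Proof. by rewrite -[LHS]/(y x + (\sum_j c j *: u j) x) fct_sumE. Qed.

(** The values of y4 and of its second derivative at both ends, indexed to form
    the rows of a matrix. *)
Definition bdry (r3 r4 : R[i]) (y2 y3 y4 : cfun) (k : 'I_4) : R[i] :=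
  [:: y4 0; y4 1; second r3 r4 y2 y3 y4 0; second r3 r4 y2 y3 y4 1]`_k.

Lemma bdry_lincomb r3 r4 n (c : 'I_n -> R[i]) (y2 y3 y4 : cfun) (u2 u3 u4 : 'I_n -> cfun) k :
  bdry r3 r4 (y2 + \sum_j c j *: u2 j) (y3 + \sum_j c j *: u3 j) (y4 + \sum_j c j *: u4 j) k
  = bdry r3 r4 y2 y3 y4 k + \sum_j c j * bdry r3 r4 (u2 j) (u3 j) (u4 j) k.
Proof.
have sec x : second r3 r4 (y2 + \sum_j c j *: u2 j) (y3 + \sum_j c j *: u3 j)
   (y4 + \sum_j c j *: u4 j) x
   = second r3 r4 y2 y3 y4 x + \sum_j c j * second r3 r4 (u2 j) (u3 j) (u4 j) x :> R[i].
  pose sc (a b c : R[i]) : R[i] := r4 * (r4 * c + b) + (r3 * b + a).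
  rewrite -[LHS]/(sc ((y2 + \sum_j c j *: u2 j) x) ((y3 + \sum_j c j *: u3 j) x)
   ((y4 + \sum_j c j *: u4 j) x)) !fct_lincomb.
  rewrite -[X in _ = X + _]/(sc (y2 x) (y3 x) (y4 x)).
  under [X in _ = _ + X]eq_bigr => j _.
    rewrite -[X in _ * X]/(sc (u2 j x) (u3 j x) (u4 j x)).
    have -> : c j * sc (u2 j x) (u3 j x) (u4 j x) = r4 * r4 * (c j * (u4 j x : R[i]))
      + (r4 + r3) * (c j * (u3 j x : R[i])) + c j * (u2 j x : R[i]) by rewrite /sc; ring.
    over.
  by rewrite !big_split/= -!mulr_sumr /sc; ring.
by case: k => [[|[|[|[|]]]] //= hk]; rewrite /bdry/= ?fct_lincomb ?sec.
Qed.

(** Fredholm alternative: the boundary values of the four homogeneous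
    cascades with unit initial values form a square matrix.  A vector in its
    kernel is the vector of initial values of a cascade that solves the homogeneous
    problem, hence vanishes.  Solving with this matrix corrects the boundary
    values of any particular solution. *)
Lemma quartic_bvp_exists (a b : R[i]) :
  (forall z p q s t : cfun, quartic_bvp a b 0 z p q s t ->
     forall x, 0 <= x <= 1 -> z x = 0) ->
  forall G : cfun, L2 G -> exists z p q s t, quartic_bvp a b G z p q s t.
Proof.
move=> uniq G LG.
have [r1 [r2 [r3 [r4 [e1 e2 e3 e4]]]]] := quartic_factor a b.
have [f1 [f2 [f3 [f4 [hf _]]]]] := cascade_exists r1 r2 r3 r4 0 0 0 0 LG.
have basis (j : 'I_4) : exists Y : cfun * cfun * (cfun * cfun),
    cascade r1 r2 r3 r4 0 Y.1.1 Y.1.2 Y.2.1 Y.2.2 /\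
    [/\ Y.1.1 0 = (j == 0)%:R, Y.1.2 0 = (j == 1)%:R, Y.2.1 0 = (j == 2)%:R
      & Y.2.2 0 = (j == 3)%:R].
  have [y1 [y2 [y3 [y4 [h i]]]]] := cascade_exists r1 r2 r3 r4 (j == 0)%:R (j == 1)%:R
    (j == 2)%:R (j == 3)%:R (@L20 R).
  by exists (y1, y2, (y3, y4)).
have {basis} [Y hY] := choice basis.
pose M := \matrix_(j, k) bdry r3 r4 (Y j).1.2 (Y j).2.1 (Y j).2.2 k.
have hu j : cascade r1 r2 r3 r4 0 (Y j).1.1 (Y j).1.2 (Y j).2.1 (Y j).2.2 by have [] := hY j.
have Munit : M \in unitmx.
  rewrite -row_free_unit -kermx_eq0; apply/rowV0P => c /sub_kermxP cM.
  have h0 : cascade r1 r2 r3 r4 0 0 0 0 (0 : cfun).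
    have d0 (r : R[i]) : is_deriv (0 : cfun) (r *: 0 + 0).
      by rewrite scaler0 addr0; exact: is_deriv_cst 0.
    by split; exact: d0.
  have := cascade_sum (c 0) h0 hu.
  set y1 := 0 + _; set y2 := 0 + _; set y3 := 0 + _; set y4 := 0 + _ => hy.
  have bk k : bdry r3 r4 y2 y3 y4 k = 0.
    rewrite /y2 /y3 /y4 bdry_lincomb.
    have -> : bdry r3 r4 0 0 0 k = 0.
      have s0 x : second r3 r4 0 0 0 x = 0 by rewrite /second !(scaler0, addr0).
      by rewrite /bdry !s0; case: k => [[|[|[|[|]]]] hk].
    rewrite add0r; move/matrixP/(_ 0 k) : cM; rewrite !mxE => {2}<-.
    by apply: eq_bigr => j _; rewrite mxE.
  have [p [q [s [t hb]]]] := cascade_bvp e1 e2 e3 e4 hy (bk 0) (bk 1) (bk 2) (bk 3).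
  have [k1 k2 k3 k4] := hy.
  have z4 := uniq _ _ _ _ _ hb.
  have z3 := cascade_zero k4 k3 z4.
  have z2 := cascade_zero k3 k2 z3.
  have z1 := cascade_zero k2 k1 z2.
  have i0 : (0 <= (0 : R)) && ((0 : R) <= 1) by apply/andP; split; [exact: lexx|exact: ler01].
  have coef m (u : 'I_4 -> cfun) : (forall j, u j 0 = (j == m)%:R) ->
      (0 + \sum_j c 0 j *: u j) 0 = 0 -> c 0 m = 0.
    move=> hu0; rewrite fct_lincomb add0r (bigD1 m)//= big1 => [|j /negPf jm].
      by rewrite hu0 eqxx mulr1 addr0.
    by rewrite hu0 jm mulr0.
  have c0 : c 0 0 = 0 by apply: coef (z1 0 i0) => j; have [_ []] := hY j.
  have c1 : c 0 1 = 0 by apply: coef (z2 0 i0) => j; have [_ []] := hY j.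
  have c2 : c 0 2 = 0 by apply: coef (z3 0 i0) => j; have [_ []] := hY j.
  have c3 : c 0 3 = 0 by apply: coef (z4 0 i0) => j; have [_ []] := hY j.
  apply/rowP => m; rewrite mxE.
  by case: m => [[|[|[|[|]]]] //= hm]; [move: c0|move: c1|move: c2|move: c3];
    move=> <-; congr (c _ _); apply/val_inj.
pose v : 'rV_4 := \row_k - bdry r3 r4 f2 f3 f4 k.
pose c := v *m invmx M.
have hy := cascade_sum (c 0) hf hu.
have bk k : bdry r3 r4 (f2 + \sum_j c 0 j *: (Y j).1.2) (f3 + \sum_j c 0 j *: (Y j).2.1)
    (f4 + \sum_j c 0 j *: (Y j).2.2) k = 0.
  rewrite bdry_lincomb.
  have : c *m M = v by rewrite mulmxKV.
  move/matrixP/(_ 0 k); rewrite !mxE => e.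
  rewrite -[X in X + _]opprK -e addrC; apply/eqP; rewrite subr_eq0; apply/eqP.
  by apply: eq_bigr => j _; congr (_ * _); rewrite mxE.
have [p [q [s [t hb]]]] := cascade_bvp e1 e2 e3 e4 hy (bk 0) (bk 1) (bk 2) (bk 3).
by exists (f4 + \sum_j c 0 j *: (Y j).2.2), p, q, s, t.
Qed.

End BvpExistence.

(** * The spectral region *)

Section SpectralRegion.
Variables (R : realType) (E C K : R).
Hypotheses (hE : 0 < E) (hC : 0 < C) (hK : 0 < K).
Local Notation be := (beta C).
Local Notation de := (delta E C).
Local Notation kk := (k_ C K).

Lemma beta_gt0 : 0 < be.
Proof. by rewrite mulr_gt0// exprn_gt0// pi_gt0. Qed.

Lemma delta_gt0 : 0 < de.
Proof. by rewrite divr_gt0. Qed.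

Lemma k_gt0 : 0 < kk.
Proof. by rewrite divr_gt0// mulr_gt0// exprn_gt0// pi_gt0. Qed.

(** k_mu^2 = q + sqrt (q^2 + k^2) exceeds k^2 as soon as 2 q > k^2 - 1, and q is
    (k^2 - 1) / 2 plus a positive term.  It follows that 0 < lam12 < beta / 2
    and lam23 < beta, which keeps the denominators in [h] positive. *)
Lemma k_mu_gt : kk < k_mu E C K.
Proof.
have k0 := k_gt0; rewrite /k_mu.
have m0 : 0 < 2 / mu_ E C ^+ 2.
  by rewrite divr_gt0// exprn_gt0// mulr_gt0 ?exprn_gt0 ?pi_gt0// divr_gt0// sqrtr_gt0.
set q := (X in X + Num.sqrt _).
have qk : kk ^+ 2 - 1 < 2 * q.
  rewrite /q mulrDr; have -> : 2 * ((kk ^+ 2 - 1) / 2) = kk ^+ 2 - 1 by field.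
  by rewrite ltrDr mulr_gt0.
have k20 : 0 < kk ^+ 2 by rewrite exprn_gt0.
have s2 : kk ^+ 2 < q + Num.sqrt (q ^+ 2 + kk ^+ 2).
  rewrite addrC -ltrBlDr.
  have [neg|pos] := ltrP (kk ^+ 2 - q) 0.
    by rewrite (lt_le_trans neg)// sqrtr_ge0.
  rewrite -[ltLHS]ger0_norm// -sqrtr_sqr ltr_sqrt.
    by nra.
  by rewrite ltr_wpDl// sqr_ge0.
rewrite -[ltLHS]ger0_norm ?ltW// -sqrtr_sqr ltr_sqrt//.
exact: lt_trans s2.
Qed.

Lemma ratio_itv : 0 < kk / k_mu E C K < 1.
Proof.
have k0 := k_gt0; have km := k_mu_gt.
by rewrite divr_gt0 ?(lt_trans k0 km)//= ltr_pdivrMr ?mul1r// (lt_trans k0 km).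
Qed.

(** The cubic is nonpositive at y0 and positive from M on, so it has a root in
    [y0, M]; its roots in [0, M] form a compact set, so there is a largest one,
    which is the value of [h3]. *)
Lemma h3_max (t y0 : R) : 0 < t -> 0 <= y0 ->
  (y0 ^+ 2 + t ^+ 2) * (y0 - kk * t) <= 2 / de * t * y0 -> y0 <= h3 E C K t.
Proof.
move=> t0 y00 hy.
have k0 := k_gt0; have d0 := delta_gt0.
pose P (y : R) := (y ^+ 2 + t ^+ 2) * (y - kk * t) - 2 / de * t * y.
have cP : continuous P.
  move=> y; apply: cvgB; last by apply: cvgM => //; exact: cvg_cst.
  apply: cvgM; last by apply: cvgB => //; exact: cvg_cst.
  apply: cvgD; last exact: cvg_cst.
  by under eq_fun do rewrite expr2; apply: cvgM.
pose c := 2 / de * t.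
have c0 : 0 < c by rewrite mulr_gt0// divr_gt0.
(* For y >= M one has y - k t >= c + 1 and y^2 >= y, so the cubic is positive. *)
pose M := kk * t + c + 1.
have kt0 : 0 < kk * t by rewrite mulr_gt0.
have bigP y : M <= y -> 0 < P y.
  rewrite /M /P -/c => My.
  have y1 : 1 < y by lra.
  have yk : c + 1 <= y - kk * t by lra.
  have : y ^+ 2 * (c + 1) <= (y ^+ 2 + t ^+ 2) * (y - kk * t).
    apply: ler_pM => //; rewrite ?sqr_ge0//; first lra.
    by rewrite lerDl sqr_ge0.
  have : y <= y ^+ 2 by rewrite expr2 ler_peMr; lra.
  nra.
have yM : y0 <= M.
  rewrite leNgt; apply/negP => /ltW/bigP; rewrite /P subr_gt0 ltNge.
  by rewrite hy.
have M0 : 0 <= M by rewrite (le_trans y00).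
have [r ry Pr] : exists2 r, r \in `[y0, M] & P r = 0.
  apply: IVT => //; first exact: continuous_subspaceT.
  have PM := bigP M (lexx M); have Py : P y0 <= 0 by rewrite subr_le0.
  by rewrite min_l ?max_r ?Py ?ltW//= (le_lt_trans Py).
have solP y : h3_sol E C K t y <-> 0 <= y /\ P y = 0.
  split=> -[a b]; split=> //; first by rewrite /P b subrr.
  by apply/eqP; rewrite -subr_eq0; apply/eqP.
pose Z := `[0, M]%classic `&` P @^-1` [set 0].
have cZ : compact Z.
  apply: (@subclosed_compact _ _ `[0, M]%classic) => //.
  - apply: closedI; first exact: itv_closed.
    by move/continuous_closedP : cP; apply; exact: closed_eq.
  - exact: segment_compact.
  - by move=> z [].
have rZ : Z r.
  by split => //=; move: ry; rewrite !in_itv/= => /andP[a ->]; rewrite andbT (le_trans y00).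
have [m /set_mem[mM Pm] mmax] : exists2 m, m \in Z & forall y, y \in Z -> y <= m.
  have cid : {within Z, continuous (fun x : R => x)}.
    by apply: continuous_subspaceT => x; exact: cvg_id.
  by apply: compact_EVT_max cZ cid; exists r.
have hm : h3_sol E C K t m /\ forall y', h3_sol E C K t y' -> y' <= m.
  split; first by apply/solP; split => //; move: mM; rewrite /= in_itv/= => /andP[].
  move=> y' /solP[y'0 Py']; apply: mmax; apply/mem_set; split => //=.
  rewrite in_itv/= y'0/= leNgt; apply/negP => /ltW/bigP.
  by rewrite Py' ltxx.
have [_ hmax] := @xgetPex _ 0 [set y | h3_sol E C K t y /\
  forall y', h3_sol E C K t y' -> y' <= y] (ex_intro _ m hm).
rewrite /h3; apply: le_trans (hmax r _); last first.
  by apply/solP; split => //; case: rZ => /=; rewrite in_itv/= => /andP[].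
by move: ry; rewrite in_itv/= => /andP[].
Qed.

Definition in_region (x y : R) : Prop :=
  [/\ x < 0, `| `|x| - be / 2 | ^+ 2 >= (be / 2) ^+ 2 * (1 - 4 / (be * de)) &
      `|y| <= h E C K `|x| ].

(** Real and imaginary parts of 1 + lam delta + i lam kappa + lam^2 n for
    lam = x + i y: the quadratic form of the pencil at z divided by
    a = E |z''|^2, with n = |z|^2 / a and i kappa = K <z', z> / a. *)
Definition symb_re (x y n kap : R) := 1 + de * x - y * kap + (x ^+ 2 - y ^+ 2) * n.
Definition symb_im (x y n kap : R) := de * y + x * kap + 2 * x * y * n.

(** Put t = - x and s = x^2 + y^2.  Multiplying the equation by the conjugate
    of lam and separating real and imaginary parts gives n s t = delta s - t and
    kappa s t = y (2 t - delta s).  The bound on n becomes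
    delta s (beta - t) <= beta t, which together with s >= t^2 yields the
    strip condition and, solved for y^2, the middle case of [h].  The bound on
    kappa becomes |y| |2 t - delta s| <= k delta s t: one sign of
    2 t - delta s gives the first case of [h], with s estimated by the previous
    inequality, and the other sign gives the cubic inequality of the last
    case. *)
Lemma symb_zero_region x y n kap : 0 <= n <= de / be -> `|kap| <= kk * de ->
  symb_re x y n kap = 0 -> symb_im x y n kap = 0 -> in_region x y.
Proof.
move=> /andP[n0 n1] kap1 Zr Zi.
have b0 := beta_gt0; have d0 := delta_gt0; have k0 := k_gt0.
have [rat0 rat1] := andP ratio_itv.
pose s := x ^+ 2 + y ^+ 2.
have s0 : 0 < s.
  rewrite lt_neqAle addr_ge0 ?sqr_ge0// andbT eq_sym.
  apply/negP; rewrite /s paddr_eq0 ?sqr_ge0// !sqrf_eq0 => /andP[/eqP x0 /eqP y0].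
  move: Zr; rewrite /symb_re x0 y0 => /eqP; apply/negP; apply: lt0r_neq0; nra.
have Er : x + de * s + x * s * n = 0.
  have -> : x + de * s + x * s * n = x * symb_re x y n kap + y * symb_im x y n kap.
    by rewrite /symb_re /symb_im /s; ring.
  by rewrite Zr Zi; ring.
have Ei : - y + kap * s + y * s * n = 0.
  have -> : - y + kap * s + y * s * n = x * symb_im x y n kap - y * symb_re x y n kap.
    by rewrite /symb_re /symb_im /s; ring.
  by rewrite Zr Zi; ring.
have sn0 : 0 <= s * n by rewrite mulr_ge0// ltW.
have ds0 : 0 < de * s by rewrite mulr_gt0.
have x0 : x < 0 by nra.
have xabs : `|x| = - x by rewrite ltr0_norm.
pose t := - x; have tx : `|x| = t := xabs; have t0 : 0 < t by rewrite oppr_gt0.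
have nst : n * s * t = de * s - t by rewrite /t; lra.
have nb : n * be <= de by rewrite -ler_pdivlMr.
have st0 : 0 < s * t by rewrite mulr_gt0.
have N1 : de * s * (be - t) <= be * t.
  have : n * be * (s * t) <= de * (s * t) by rewrite ler_wpM2r// ltW.
  have -> : n * be * (s * t) = be * (n * s * t) by ring.
  rewrite nst; nra.
have kst : kap * s * t = y * (2 * t - de * s).
  have -> : y * (2 * t - de * s) = y * t - y * (de * s - t) by ring.
  rewrite -nst; have -> : kap * s = y - y * s * n by lra.
  ring.
have N2 : `|y| * `|2 * t - de * s| <= kk * de * (s * t).
  rewrite -normrM -kst -mulrA normrM (gtr0_norm st0) ler_wpM2r// ltW//.
have ys : y ^+ 2 = s - t ^+ 2 by rewrite /s /t; ring.
have s2 : t ^+ 2 <= s by rewrite -subr_ge0 -ys sqr_ge0.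
have ay0 : 0 <= `|y| by [].
clearbody t; clearbody s.
have D0 : t ^+ 2 - be * t + be / de >= 0.
  have e : be = be / de * de by rewrite divfK// gt_eqF.
  have bd0 : 0 < be / de by rewrite divr_gt0.
  have [tb|tb] := ltrP t be; last by nra.
  have : de * t ^+ 2 * (be - t) <= be * t.
    apply: le_trans N1; rewrite ler_wpM2r ?subr_ge0 ?(ltW tb)// ler_wpM2l// ltW//.
  move=> hh; have : t * (de * (t * (be - t) - be / de)) <= 0.
    have -> : t * (de * (t * (be - t) - be / de)) =
      de * t ^+ 2 * (be - t) - t * (be / de * de) by ring.
    rewrite -e; nra.
  rewrite pmulr_rle0// pmulr_rle0//; nra.
split => //.
- rewrite tx real_normK ?num_real//.
  have -> : (be / 2) ^+ 2 * (1 - 4 / (be * de)) = (be / 2) ^+ 2 - be / de.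
    by field; rewrite !gt_eqF.
  rewrite -subr_ge0; have -> : (t - be / 2) ^+ 2 - ((be / 2) ^+ 2 - be / de) =
    t ^+ 2 - be * t + be / de by field; rewrite gt_eqF.
  exact: D0.
- rewrite tx /h.
  case: ifPn => [tl|tl].
    have tb : 2 * t < be.
      have : t < be / 2 by apply: lt_le_trans tl _; rewrite /lam12 ler_piMr; lra.
      lra.
    have -> : kk * t / (1 - 2 / be * t) = kk * be * t / (be - 2 * t).
      have b2 : be - 2 * t != 0 by rewrite subr_eq0 gt_eqF.
      by field; rewrite b2 gt_eqF.
    rewrite ler_pdivlMr ?subr_gt0//.
    have h1 : `|y| * (2 * t - de * s) <= kk * de * (s * t).
      by apply: le_trans N2; rewrite ler_wpM2l// ler_norm.
    have h2 : `|y| * (2 * de * s * (be - t)) <= `|y| * (2 * (be * t)).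
      by rewrite ler_wpM2l//; nra.
    have h3 : be * (`|y| * (2 * t - de * s)) <= be * (kk * de * (s * t)) by rewrite ler_pM2l.
    rewrite -(ler_pM2r ds0).
    have -> : `|y| * (be - 2 * t) * (de * s) =
      `|y| * (2 * de * s * (be - t)) - be * (`|y| * (de * s)) by ring.
    have -> : kk * be * t * (de * s) = be * (kk * de * (s * t)) by ring.
    apply: le_trans h3.
    have -> : be * (`|y| * (2 * t - de * s)) =
      `|y| * (2 * (be * t)) - be * (`|y| * (de * s)) by ring.
    by rewrite lerB.
  case: ifPn => [tm|tm].
    have tb : t < be.
      by apply: le_lt_trans tm _; rewrite /lam23; nra.
    rewrite -(sqrtr_sqr y) ler_wsqrtr// ys lerB//.
    have -> : be / de * (t / (be - t)) = be * t / (de * (be - t)).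
      have b2 : be - t != 0 by rewrite subr_eq0 gt_eqF.
      by field; rewrite b2 gt_eqF.
    rewrite ler_pdivlMr; last by rewrite mulr_gt0// subr_gt0.
    by apply: le_trans N1; rewrite mulrA [s * _]mulrC.
  apply: h3_max => //.
  have h1 : `|y| * (de * s - 2 * t) <= kk * de * (s * t).
    apply: le_trans N2; rewrite ler_wpM2l//.
    by rewrite -(opprB (2 * t)) (le_trans (ler_norm _))// normrN.
  have -> : `|y| ^+ 2 + t ^+ 2 = s by rewrite real_normK ?num_real// ys subrK.
  rewrite -(ler_pM2l d0); have -> : de * (2 / de * t * `|y|) = 2 * t * `|y|.
    by field; rewrite gt_eqF.
  nra.
Qed.

(** A continuous function without zeros on a compact rectangle. *)
Lemma symb_bounded_below x y : ~ in_region x y -> exists2 c, 0 < c &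
  forall n kap, 0 <= n <= de / be -> `|kap| <= kk * de ->
    c <= symb_re x y n kap ^+ 2 + symb_im x y n kap ^+ 2.
Proof.
move=> hxy.
pose F (p : R * R) := symb_re x y p.1 p.2 ^+ 2 + symb_im x y p.1 p.2 ^+ 2.
pose A : set (R * R) := `[0, de / be]%classic `*` `[- (kk * de), kk * de]%classic.
have b0 := beta_gt0; have d0 := delta_gt0; have k0 := k_gt0.
have cF : continuous F.
  have c1 (p : R * R) : (fun q : R * R => q.1) @ p --> p.1 by exact: cvg_fst.
  have c2 (p : R * R) : (fun q : R * R => q.2) @ p --> p.2 by exact: cvg_snd.
  have cr : continuous (fun p : R * R => symb_re x y p.1 p.2).
    move=> p; apply: cvgD; last by apply: cvgM; [exact: cvg_cst|exact: c1].
    by apply: cvgB; [exact: cvg_cst|apply: cvgM; [exact: cvg_cst|exact: c2]].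
  have ci : continuous (fun p : R * R => symb_im x y p.1 p.2).
    move=> p; apply: cvgD; last by apply: cvgM; [exact: cvg_cst|exact: c1].
    by apply: cvgD; [exact: cvg_cst|apply: cvgM; [exact: cvg_cst|exact: c2]].
  rewrite /F; under eq_fun do rewrite !expr2.
  by move=> p; apply: cvgD; apply: cvgM; [exact: cr|exact: cr|exact: ci|exact: ci].
have A0 : A !=set0.
  have kd : 0 <= kk * de by rewrite mulr_ge0// ltW.
  have bd : 0 <= de / be by rewrite divr_ge0// ltW.
  by exists (0, 0); split; rewrite /= in_itv/= ?lexx ?bd ?oppr_le0 ?kd.
have cA : compact A by apply: compact_setX; exact: segment_compact.
have [m /set_mem[m1 m2] hm] := compact_EVT_min A0 cA (continuous_subspaceT cF).
exists (F m).
  rewrite lt_neqAle addr_ge0 ?sqr_ge0// andbT eq_sym; apply/negP.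
  rewrite paddr_eq0 ?sqr_ge0// !sqrf_eq0 => /andP[/eqP zr /eqP zi].
  apply: hxy; apply: symb_zero_region zr zi; first by move: m1; rewrite /= in_itv.
  by move: m2; rewrite /= in_itv/= ler_norml.
move=> n kap hn hk; apply: (hm (n, kap)); apply/mem_set; split => /=; rewrite in_itv//=.
by rewrite -ler_norml.
Qed.

End SpectralRegion.

(** * The resolvent *)

Section Resolvent.
Variable R : realType.
Local Notation cfun := (R -> R[i]^o).
Local Notation toC := (real_complex R).
Local Notation Re := complex.Re.
Local Notation Im := complex.Im.
Local Notation normc := ComplexField.Normc.normc.

Definition nrm (f : cfun) : R := Num.sqrt (nrm2 f).

Lemma nrm_ge0 f : 0 <= nrm f. Proof. exact: sqrtr_ge0. Qed.

Lemma nrm_sqr f : nrm f ^+ 2 = nrm2 f.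
Proof. by rewrite sqr_sqrtr// nrm2_ge0. Qed.

Lemma normcE (a : R[i]) : normc a = Num.sqrt (Re a ^+ 2 + Im a ^+ 2).
Proof. by case: a. Qed.

Lemma normc_ge0 (a : R[i]) : 0 <= normc a.
Proof. by rewrite normcE sqrtr_ge0. Qed.

Lemma normc_real (r : R) : normc (toC r) = `|r|.
Proof. by rewrite normcE/= expr0n/= addr0 sqrtr_sqr. Qed.

Lemma le_normD (a b : R[i]) : normc (a + b) <= normc a + normc b.
Proof. exact: le_normcD. Qed.

Lemma normc_opp (a : R[i]) : normc (- a) = normc a.
Proof. exact: normcN. Qed.

Lemma normc_ip f g : L2 f -> L2 g -> normc (ip f g) <= nrm f * nrm g.
Proof.
move=> Lf Lg; rewrite normcE -sqrtrM ?nrm2_ge0// ler_wsqrtr//.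
exact: cauchy_schwarz.
Qed.

Lemma nrmD f g : L2 f -> L2 g -> nrm (f + g) <= nrm f + nrm g.
Proof.
move=> Lf Lg; have fg0 : 0 <= nrm f + nrm g by rewrite addr_ge0 ?nrm_ge0.
rewrite -(@ler_pXn2r _ 2)// ?nnegrE ?nrm_ge0// nrm_sqr nrm2D// sqrrD !nrm_sqr.
have h : Re (ip f g) <= nrm f * nrm g.
  apply: le_trans (normc_ip Lf Lg); rewrite normcE.
  by apply: le_trans (ler_norm _) _; rewrite -sqrtr_sqr ler_wsqrtr// lerDl sqr_ge0.
by move: h; lra.
Qed.

Lemma nrmZ (a : R[i]) f : L2 f -> nrm (a *: f) = normc a * nrm f.
Proof. by move=> Lf; rewrite /nrm nrm2Z// sqrtrM ?addr_ge0 ?sqr_ge0// normcE. Qed.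

Lemma nrm2_0 : nrm2 (0 : cfun) = 0.
Proof.
rewrite -(scale0r (0 : cfun)) nrm2Z//; last exact: L20.
by rewrite /= expr0n/= addr0 mul0r.
Qed.

(** Only boundedness matters for the resolvent, so pi >= 1 suffices here. *)
Lemma dirichlet_crude (z p q : cfun) : dirichlet z p q -> nrm z <= nrm q /\ nrm p <= nrm q.
Proof.
move=> hz; have := poincare hz; have := poincare2 hz.
have p1 : 1 <= (pi : R) by apply: le_trans (pi_ge2 R); rewrite ler1n.
move=> h2 h4; split; rewrite ler_wsqrtr//.
- by apply: le_trans h4; rewrite ler_peMl ?nrm2_ge0// exprn_ege1.
- by apply: le_trans h2; rewrite ler_peMl ?nrm2_ge0// exprn_ege1.
Qed.

Variables E C K : R.
Hypotheses (hE : 0 < E) (hC : 0 < C) (hK : 0 < K).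
Variable lam : R[i].
Local Notation kk := (k_ C K).
Local Notation be := (beta C).
Local Notation de := (delta E C).

(** The leading coefficient E (1 + lam delta) of the pencil. *)
Definition bcoef : R[i] := toC E + lam * toC C.

(** The quadratic form of the operator pencil lam^2 + lam D + A0. *)
Definition pencil (z p q : cfun) : R[i] :=
  bcoef * ip q q + lam * toC K * ip p z + lam ^+ 2 * ip z z.

Variable c : R.
Hypothesis c0 : 0 < c.
Hypothesis hc : forall n kap, 0 <= n <= de / be -> `|kap| <= kk * de ->
  c <= symb_re E C (Re lam) (Im lam) n kap ^+ 2 + symb_im E C (Re lam) (Im lam) n kap ^+ 2.

(** The zero lam = - 1 / delta of [bcoef] is a zero of the symbol at
    n = kappa = 0. *)
Lemma bcoef_neq0 : bcoef != 0.
Proof.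
apply/eqP => b0; have b1 := beta_gt0 hC; have d0 := delta_gt0 hE hC.
have k0 := k_gt0 hC hK.
have := congr1 (@complex.Re R) b0; have := congr1 (@complex.Im R) b0.
rewrite /bcoef !complexEs/= !(mulr0, mul0r, addr0, add0r, subr0) => /eqP.
rewrite mulf_eq0 (gt_eqF hC) orbF => /eqP y0 xE.
have h0 : 0 <= (0 : R) <= de / be by rewrite lexx divr_ge0// ltW.
have h1 : `|0 : R| <= kk * de by rewrite normr0 mulr_ge0// ltW.
have := hc h0 h1; rewrite /symb_re /symb_im y0.
have -> : 1 + de * Re lam - 0 * 0 + (Re lam ^+ 2 - 0 ^+ 2) * 0 = (E + Re lam * C) / E.
  by rewrite /delta; field; rewrite gt_eqF.
by rewrite xE !(mulr0, mul0r, addr0) expr0n/= addr0 leNgt c0.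
Qed.

(** After division by a = E |z''|^2 the form is a value of the symbol on the
    rectangle. *)
Lemma pencil_coercive (z p q : cfun) : dirichlet z p q ->
  Num.sqrt c * (E * nrm2 q) <= normc (pencil z p q).
Proof.
move=> hz; have b1 := beta_gt0 hC; have d0 := delta_gt0 hE hC.
have [re0 im1] := dirichlet_im hz; have po := poincare hz.
have p0 := pi_gt0 R.
have [q0|qn] := eqVneq (nrm2 q) 0; first by rewrite q0 !mulr0 normc_ge0.
have qp : 0 < nrm2 q by rewrite lt_neqAle eq_sym qn nrm2_ge0.
pose a := E * nrm2 q; have a0 : 0 < a by rewrite mulr_gt0.
pose n := nrm2 z / a; pose kap := K * Im (ip p z) / a.
have pi3 : 0 < (pi : R) ^+ 3 by rewrite exprn_gt0.
have pi4 : 0 < (pi : R) ^+ 4 by rewrite exprn_gt0.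
have hn : 0 <= n <= de / be.
  apply/andP; split; first by rewrite divr_ge0 ?nrm2_ge0// ltW.
  rewrite /n ler_pdivrMr//.
  have -> : de / be * a = nrm2 q / pi ^+ 4.
    by rewrite /beta /delta /a; move: (pi : R) p0 => P P0; field; rewrite !gt_eqF.
  by rewrite ler_pdivlMr// mulrC.
have hk : `|kap| <= kk * de.
  rewrite /kap normf_div (gtr0_norm a0) ler_pdivrMr// normrM (gtr0_norm hK).
  have -> : kk * de * a = K * (nrm2 q / pi ^+ 3).
    by rewrite /k_ /delta /a; move: (pi : R) p0 => P P0; field; rewrite !gt_eqF.
  by rewrite ler_pM2l// ler_pdivlMr// mulrC.
have hre : Re (pencil z p q) = a * symb_re E C (Re lam) (Im lam) n kap.
  rewrite /pencil /bcoef !ip_self expr2; move: re0 @kap hk => + kap _.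
  rewrite /kap; move: (ip p z) => u re0; rewrite !complexEs/= re0.
  rewrite /symb_re /n /delta /a; field; rewrite !gt_eqF//.
have him : Im (pencil z p q) = a * symb_im E C (Re lam) (Im lam) n kap.
  rewrite /pencil /bcoef !ip_self expr2; move: re0 @kap hk {hre} => + kap _.
  rewrite /kap; move: (ip p z) => u re0; rewrite !complexEs/= re0.
  rewrite /symb_im /n /delta /a; field; rewrite !gt_eqF//.
rewrite normcE hre him -/a.
have -> : Num.sqrt c * a = Num.sqrt (a ^+ 2 * c).
  by rewrite sqrtrM ?sqr_ge0// sqrtr_sqr gtr0_norm// mulrC.
apply: ler_wsqrtr; have := hc hn hk; rewrite !exprMn -mulrDr => h.
by apply: ler_wpM2l h; rewrite -exprMn sqr_ge0.
Qed.

(** The chosen derivatives [d2] may be replaced by any others. *)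
Lemma ip_half_dirichlet (z p q v pv qv : cfun) :
  dirichlet z p q -> dirichlet v pv qv -> ip (d2 z) (d2 v) = ip q qv.
Proof.
move=> hz hv; have [a b _ _] := hz; have [a' b' _ _] := hv.
have [_ e] := d2_unique (z := z) (p := p) (q := q) (conj a b).
have [_ e'] := d2_unique (z := v) (p := pv) (q := qv) (conj a' b').
have [_ _ Lq] := dirichlet_L2 hz; have [_ _ Lqv] := dirichlet_L2 hv.
have [_ _ Ld] := dirichlet_L2 (HhalfP (dirichlet_Hhalf hz)).
have [_ _ Ldv] := dirichlet_L2 (HhalfP (dirichlet_Hhalf hv)).
by rewrite (ip_eql Ld Lq Ldv e) (ip_eqr Ldv Lqv Lq e').
Qed.

Lemma ip_d1_dirichlet (z p q v : cfun) : dirichlet z p q -> L2 v -> ip (d1 z) v = ip p v.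
Proof.
move=> hz Lv; have [a b _ _] := hz.
have [e _] := d2_unique (z := z) (p := p) (q := q) (conj a b).
rewrite !ipE; congr Complex; apply: eq_int01 => x; rewrite /= in_itv/= => Ix;
  by rewrite e.
Qed.

Lemma form_dirichlet (z p q w pw qw v pv qv : cfun) :
  dirichlet z p q -> dirichlet w pw qw -> dirichlet v pv qv ->
  A0 E z v + Dop E C K w v =
  toC E * ip q qv + (toC C * ip qw qv + toC K * ip pw v).
Proof.
move=> hz hw hv; have [Lv _ _] := dirichlet_L2 hv.
rewrite /Dop /A0 /ip_half (ip_half_dirichlet hz hv) (ip_half_dirichlet hw hv).
rewrite (ip_d1_dirichlet hw Lv) mulrA.
have -> // : toC (C / E) * toC E = toC C.
by rewrite -rmorphM/= divfK// gt_eqF.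
Qed.

Lemma norm_state_dirichlet (z p q w : cfun) : dirichlet z p q ->
  norm_state E (z, w) = Num.sqrt (E * nrm2 q + nrm2 w).
Proof.
move=> hz; rewrite /norm_state /ip_half -[(z, w).1]/z -[(z, w).2]/w.
rewrite (ip_half_dirichlet hz hz) !ip_self.
by rewrite ReM/= mul0r subr0.
Qed.

Lemma norm_state_bounds (z p q w : cfun) : dirichlet z p q ->
  [/\ norm_state E (z, w) <= Num.sqrt E * nrm q + nrm w,
      Num.sqrt E * nrm q <= norm_state E (z, w) & nrm w <= norm_state E (z, w)].
Proof.
move=> hz; rewrite (norm_state_dirichlet w hz).
have e : Num.sqrt E * nrm q = Num.sqrt (E * nrm2 q) by rewrite sqrtrM// ltW.
have q0 : 0 <= E * nrm2 q by rewrite mulr_ge0 ?nrm2_ge0// ltW.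
split.
- rewrite e -(@ler_pXn2r _ 2)// ?nnegrE ?addr_ge0 ?sqrtr_ge0//.
  rewrite sqrrD !sqr_sqrtr ?addr_ge0 ?nrm2_ge0//.
  by rewrite lerD2r lerDl mulrn_wge0// mulr_ge0 ?sqrtr_ge0.
- by rewrite e ler_wsqrtr// lerDl nrm2_ge0.
- by rewrite /nrm ler_wsqrtr// lerDr.
Qed.

Lemma ip_shift (f g v : cfun) : L2 f -> L2 g -> L2 v ->
  ip (f - lam *: g) v = ip f v - lam * ip g v.
Proof. by move=> Lf Lg Lv; rewrite ipDl// ?ipNl ?ipZl//; do ?[apply: L2N|exact: L2Z]. Qed.

Lemma dirichlet_shift (z p q w pw qw : cfun) : dirichlet z p q -> dirichlet w pw qw ->
  dirichlet (w - lam *: z) (pw - lam *: p) (qw - lam *: q).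
Proof. by move=> hz hw; rewrite -!scaleNr; apply: dirichletD => //; exact: dirichletZ. Qed.

(** For x = (z, w) and y = (w, u), testing the weak equation with v = z
    expresses the form of the pencil at z through f = w - lam z and
    g = u - lam w; coercivity then bounds |z''| by
    |f''| and |g|, and w = lam z + f. *)
Lemma resolvent_bound : exists M, forall x y, calA E C K x y ->
  norm_state E x <= M * norm_state E (y - lam *: x).
Proof.
pose L := normc lam; have L0 : 0 <= L := normc_ge0 lam.
pose A := Num.sqrt c * E; have A0 : 0 < A by rewrite mulr_gt0// sqrtr_gt0.
pose e := Num.sqrt E; have e0 : 0 < e by rewrite sqrtr_gt0.
exists ((e + L) * (((C + K + L) / e + 1) / A) + e^-1).
move=> [z w] [y1 u] [/= Hz Hw -> Lu weak].
have hz := HhalfP Hz; have hw := HhalfP Hw.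
move: (d1 z) (d2 z) (d1 w) (d2 w) hz hw => p q pw qw hz hw.
have [Lz Lp Lq] := dirichlet_L2 hz; have [Lw Lpw Lqw] := dirichlet_L2 hw.
have hf := dirichlet_shift hz hw; have [Lf Lpf Lqf] := dirichlet_L2 hf.
pose g := u - lam *: w; have Lg : L2 g by apply: L2B => //; exact: L2Z.
have W := weak z Hz; rewrite (form_dirichlet hz hw hz) (ipNl Lu Lz) in W.
have T : pencil z p q = - (toC C * ip (qw - lam *: q) q + toC K * ip (pw - lam *: p) z
    + ip g z + lam * ip (w - lam *: z) z).
  rewrite /g !ip_shift// /pencil /bcoef.
  move: W; move: (ip q q) (ip qw q) (ip pw z) (ip u z) => a1 a2 a3 a4 W.
  rewrite [LHS](_ : _ = (toC E * a1 + (toC C * a2 + toC K * a3))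
    + (lam * toC C * a1 - toC C * a2 - toC K * a3)
    + lam * toC K * ip p z + lam ^+ 2 * ip z z); last by ring.
  by rewrite W; ring.
set f := w - lam *: z in hf Lf T; set pf := pw - lam *: p in hf Lpf T.
set qf := qw - lam *: q in hf Lqf T.
have [nz np] := dirichlet_crude hz; have [nf npf] := dirichlet_crude hf.
have Tb : normc (pencil z p q) <= ((C + K + L) * nrm qf + nrm g) * nrm q.
  have hmul (a : R) (u1 v1 : cfun) (M : R) : 0 <= a -> L2 u1 -> L2 v1 ->
      nrm u1 * nrm v1 <= M -> a * normc (ip u1 v1) <= a * M.
    by move=> a0 h1 h2 hM; rewrite ler_wpM2l// (le_trans (normc_ip h1 h2)).
  have m1 := hmul _ _ _ _ (ltW hC) Lqf Lq (lexx _).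
  have m2 : K * normc (ip pf z) <= K * (nrm qf * nrm q).
    by apply: hmul => //; [exact: ltW|apply: ler_pM; rewrite ?nrm_ge0].
  have m3 : normc (ip g z) <= nrm g * nrm q.
    by apply: le_trans (normc_ip Lg Lz) _; rewrite ler_wpM2l ?nrm_ge0.
  have m4 : L * normc (ip f z) <= L * (nrm qf * nrm q).
    by apply: hmul => //; apply: ler_pM; rewrite ?nrm_ge0.
  rewrite T normc_opp.
  apply: le_trans (le_normD _ _) _; rewrite ComplexField.Normc.normcM -/L.
  have := le_normD (toC C * ip qf q + toC K * ip pf z) (ip g z).
  have := le_normD (toC C * ip qf q) (toC K * ip pf z).
  rewrite !ComplexField.Normc.normcM !normc_real (gtr0_norm hC) (gtr0_norm hK).
  move: m1 m2 m3 m4; lra.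
have co := pencil_coercive hz.
have qb : A * nrm q <= (C + K + L) * nrm qf + nrm g.
  have [q0|qn] := eqVneq (nrm q) 0.
    by rewrite q0 mulr0 addr_ge0 ?mulr_ge0 ?nrm_ge0// !addr_ge0// ltW.
  have qp : 0 < nrm q by rewrite lt_neqAle eq_sym qn nrm_ge0.
  rewrite -(ler_pM2r qp); apply: le_trans Tb; apply: le_trans co.
  by rewrite -nrm_sqr /A expr2 !mulrA.
have nw : nrm w <= L * nrm z + nrm f.
  rewrite -[w in leLHS](subrK (lam *: z)) -/f addrC.
  by apply: le_trans (nrmD (L2Z lam Lz) Lf) _; rewrite nrmZ.
have [b1 _ _] := norm_state_bounds w hz.
have [_ b2 b3] := norm_state_bounds g hf.
rewrite -[(w, u) - lam *: (z, w)]/(f, g).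
set S := norm_state E (f, g) in b2 b3 *.
have S1 : nrm qf <= e^-1 * S by rewrite mulrC ler_pdivlMr// mulrC.
pose B := ((C + K + L) / e + 1) / A.
have qB : nrm q <= B * S.
  rewrite -(ler_pM2l A0); have -> : A * (B * S) = (C + K + L) * (e^-1 * S) + S.
    by rewrite /B; field; rewrite !gt_eqF.
  apply: (le_trans qb); rewrite lerD// ler_wpM2l//.
  by rewrite !addr_ge0// ltW.
apply: (le_trans b1); rewrite -/B -/e mulrDl -mulrA mulrDl.
have : L * nrm z <= L * (B * S) by rewrite ler_wpM2l// (le_trans nz).
have : e * nrm q <= e * (B * S) by rewrite ler_wpM2l// ltW.
move: nw nf S1; lra.
Qed.

End Resolvent.

Section Surjectivity.
Variable R : realType.
Local Notation cfun := (R -> R[i]^o).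
Local Notation toC := (real_complex R).
Local Notation Re := complex.Re.
Local Notation Im := complex.Im.
Variables E C K : R.
Hypotheses (hE : 0 < E) (hC : 0 < C) (hK : 0 < K).
Variable lam : R[i].
Local Notation kk := (k_ C K).
Local Notation be := (beta C).
Local Notation de := (delta E C).
Variable c : R.
Hypothesis c0 : 0 < c.
Hypothesis hc : forall n kap, 0 <= n <= de / be -> `|kap| <= kk * de ->
  c <= symb_re E C (Re lam) (Im lam) n kap ^+ 2 + symb_im E C (Re lam) (Im lam) n kap ^+ 2.
Local Notation b := (bcoef E C lam).

Lemma ip_twice_by_parts (q s t v pv qv : cfun) : dirichlet q s t -> dirichlet v pv qv ->
  ip t v = ip q qv.
Proof.
move=> [qs st q0 q1] [vp pq v0 v1].
have h1 := ip_by_parts st vp; have h2 := ip_by_parts qs pq.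
rewrite v0 v1 conjc0 !mulr0 subrr in h1; rewrite q0 q1 !mul0r subrr in h2.
apply: (@addIr _ (ip s pv)); rewrite h1.
by rewrite addrC h2.
Qed.

(** A solution of the homogeneous problem makes the form of the pencil
    vanish, so coercivity applies. *)
Lemma pencil_bvp_unique (z p q s t : cfun) :
  quartic_bvp (lam * toC K / b) (lam ^+ 2 / b) 0 z p q s t ->
  forall x, 0 <= x <= 1 -> z x = 0.
Proof.
move=> [hz hq ht]; have b0 := bcoef_neq0 hE hC hK c0 hc.
have [Lz Lp Lq] := dirichlet_L2 hz; have [_ _ Lt] := dirichlet_L2 hq.
have e := ip_twice_by_parts hq hz.
have P0 : pencil E C K lam z p q = 0.
  have key (b' u v i1 i2 : R[i]) : b' != 0 ->
      b' * (- (u / b') * i1 + - (v / b') * i2) + u * i1 + v * i2 = 0.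
    by move=> h; field.
  rewrite /pencil -e ht sub0r -(scaleNr _ p) -(scaleNr _ z) ipDl ?ipZl//;
    do ?[exact: L2Z|exact: key].
have := pencil_coercive hE hC hK hc hz; rewrite P0 ComplexField.Normc.normc0.
rewrite pmulr_rle0 ?sqrtr_gt0// pmulr_rle0// => q0.
have z0 : nrm2 z = 0.
  apply/eqP; rewrite eq_le nrm2_ge0 andbT.
  have p4 : 0 < (pi : R) ^+ 4 by rewrite exprn_gt0// pi_gt0.
  by rewrite -(pmulr_rle0 _ p4) (le_trans (poincare hz)).
by have [dz _ _ _] := hz; exact: is_deriv_zero dz z0.
Qed.

(** The function solving the boundary value problem is z + (C / b) f, not z:
    the datum f enters the equation with its fourth derivative, which need
    not exist, and this shift absorbs it. *)
Lemma resolvent_onto (f : cfun * cfun) : Hstate f -> exists x y,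
  calA E C K x y /\ norm_state E (y - lam *: x - f) = 0.
Proof.
case: f => f g [/= Hf Lg]; have hf := HhalfP Hf.
move: (d1 f) (d2 f) hf => pf qf hf; have [Lf Lpf _] := dirichlet_L2 hf.
have b0 := bcoef_neq0 hE hC hK c0 hc.
pose r : R[i] := toC C / b.
pose G : cfun := b^-1 *: (- g + (lam ^+ 2 * r - lam) *: f + (lam * toC K * r - toC K) *: pf).
have LG : L2 G.
  by apply: L2Z; apply: L2D; [apply: L2D; [exact: L2N|exact: L2Z]|exact: L2Z].
have [z [p [q [s [t [hz hq ht]]]]]] := quartic_bvp_exists pencil_bvp_unique LG.
have hzf := dirichletD hz (dirichletZ (- r) hf).
pose z' := z + (- r) *: f; pose p' := p + (- r) *: pf; pose q' := q + (- r) *: qf.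
have hw := dirichletD (dirichletZ lam hzf) hf.
pose w := lam *: z' + f; pose pw := lam *: p' + pf; pose qw := lam *: q' + qf.
rewrite -/z' -/p' -/q' in hzf hw; rewrite -/w -/pw -/qw in hw.
have [Lz Lp Lq] := dirichlet_L2 hz; have [Lw Lpw Lqw] := dirichlet_L2 hw.
have [_ _ Lt] := dirichlet_L2 hq; have [_ _ Lq'] := dirichlet_L2 hzf.
pose u := lam *: w + g.
have Lu : L2 u by apply: L2D => //; exact: L2Z.
exists (z', w), (w, u); split; last first.
  have -> : (w, u) - lam *: (z', w) - (f, g) = (0, 0) :> cfun * cfun.
    congr pair; rewrite -?[LHS]/(w - lam *: z' - f) -?[LHS]/(u - lam *: w - g).
      by rewrite /w [_ + f]addrC addrK subrr.
    by rewrite /u [_ + g]addrC addrK subrr.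
  have d0 : dirichlet (0 : cfun) 0 0 by split=> //; exact: is_deriv_cst 0.
  by rewrite (norm_state_dirichlet _ _ d0)// nrm2_0 mulr0 addr0 sqrtr0.
split => //=; [exact: dirichlet_Hhalf hzf|exact: dirichlet_Hhalf hw|].
move=> v Hv; have hv := HhalfP Hv.
move: (d1 v) (d2 v) hv => pv qv hv; have [Lv Lpv Lqv] := dirichlet_L2 hv.
rewrite (form_dirichlet C K hE hzf hw hv) (ipNl Lu Lv).
have e1 : toC E * ip q' qv + toC C * ip qw qv = b * ip q qv.
  have -> : toC E * ip q' qv + toC C * ip qw qv = ip (toC E *: q' + toC C *: qw) qv.
    by rewrite (ipDl (L2Z (toC E) Lq') (L2Z (toC C) Lqw) Lqv) (ipZl Lq' Lqv) (ipZl Lqw Lqv).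
  rewrite -(ipZl Lq Lqv); congr ip; apply/funext => x.
  have key (E' C' l y1 y2 : R[i]) : E' + l * C' != 0 ->
     E' * (y1 + - (C' / (E' + l * C')) * y2)
     + C' * (l * (y1 + - (C' / (E' + l * C')) * y2) + y2) = (E' + l * C') * y1.
    by move=> h; field.
  exact: key b0.
have e2 : b *: t = - (toC K *: pw + u).
  have key (b' K' l r' y1 y2 y3 y4 y5 : R[i]) : b' != 0 ->
     b' * (b'^-1 * (- y1 + (l ^+ 2 * r' - l) * y2 + (l * K' * r' - K') * y3)
       - (l * K' / b') * y4 - (l ^+ 2 / b') * y5) =
     - (K' * (l * (y4 + - r' * y3) + y3) + (l * (l * (y5 + - r' * y2) + y2) + y1)).
    by move=> h; field.
  by rewrite ht; apply/funext => x; exact: key b0.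
rewrite addrA e1 -(ip_twice_by_parts hq hv) -(ipZl Lt Lv) e2.
have LKpw := L2Z (toC K) Lpw.
rewrite (ipNl (L2D LKpw Lu) Lv) (ipDl LKpw Lu Lv) (ipZl Lpw Lv).
by ring.
Qed.

Lemma in_resolvent : resolvent_set (@Hstate R) (norm_state E) (calA E C K) lam.
Proof.
have [M hM] := resolvent_bound hE hC hK c0 hc.
split.
- move=> x y Txy e0; apply/eqP; rewrite eq_le sqrtr_ge0 andbT.
  by have := hM x y Txy; rewrite e0 mulr0.
- by move=> f Hf; exact: resolvent_onto.
- by exists M.
Qed.

End Surjectivity.

Theorem theorem8p2 (R : realType) (E C K : R)
    (hE : 0 < E) (hC : 0 < C) (hK : 0 < K) :
  sigmaA E C K `<=`
    [set lam : R[i] |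
      [/\ complex.Re lam < 0,
          `| `|complex.Re lam| - beta C / 2 | ^+ 2
            >= (beta C / 2) ^+ 2 * (1 - 4 / (beta C * delta E C)) &
          `|complex.Im lam| <= h E C K `|complex.Re lam| ]]
  /\
  (2 * Num.sqrt E / pi ^+ 2 < C ->
    [set complex.Re lam | lam in sigmaA E C K] `&`
      `] - (C * pi ^+ 4 / 2 * (1 + Num.sqrt (1 - 4 * E / (C ^+ 2 * pi ^+ 4)))),
         - (C * pi ^+ 4 / 2 * (1 - Num.sqrt (1 - 4 * E / (C ^+ 2 * pi ^+ 4)))) [
    = set0).
Proof.
have incl : sigmaA E C K `<=` [set lam | in_region E C K (complex.Re lam) (complex.Im lam)].
  move=> lam slam /=; apply: contrapT => /(symb_bounded_below hE hC hK)[c c0 hc].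
  by apply: slam; exact: (in_resolvent hE hC hK c0 hc).
split=> [|hCE]; first exact: incl.
apply/seteqP; split=> // x [[lam /incl[re0 strip _] <-]] /=.
rewrite in_itv/=; move: re0 strip; move: (complex.Re lam) => {}x x0.
rewrite (ltr0_norm x0) real_normK ?num_real//.
have -> : 1 - 4 / (beta C * delta E C) = 1 - 4 * E / (C ^+ 2 * pi ^+ 4).
  rewrite /beta /delta; have := pi_gt0 R; move: (pi : R) => P P0.
  by field; rewrite !gt_eqF.
have D0 : 0 < 1 - 4 * E / (C ^+ 2 * pi ^+ 4).
  have p2 : 0 < (pi : R) ^+ 2 by rewrite exprn_gt0// pi_gt0.
  rewrite subr_gt0 ltr_pdivrMr ?mul1r; last by rewrite mulr_gt0// exprn_gt0// pi_gt0.
  have := hCE; rewrite ltr_pdivrMr// => h.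
  have -> : C ^+ 2 * pi ^+ 4 = (C * pi ^+ 2) ^+ 2 by ring.
  have -> : 4 * E = (2 * Num.sqrt E) ^+ 2 by rewrite exprMn sqr_sqrtr ?ltW//; ring.
  by rewrite ltrXn2r// ?nnegrE ?mulr_ge0 ?sqrtr_ge0 ?ltW.
rewrite -/(beta C); have b0 := beta_gt0 hC.
move: (beta C) b0 => B B0.
set D := 1 - _ in D0 *.
have s2 : Num.sqrt D ^+ 2 = D by rewrite sqr_sqrtr// ltW.
have s0 : 0 < Num.sqrt D by rewrite sqrtr_gt0.
move: (Num.sqrt D) s2 s0 => S <- S0 strip /andP[l1 l2].
have : `| - x - B / 2 | < B / 2 * S by rewrite ltr_norml; apply/andP; split; lra.
rewrite -(@ltr_pXn2r _ 2)// ?nnegrE ?mulr_ge0 ?ltW ?divr_gt0//.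
rewrite real_normK ?num_real// exprMn ltNge => /negP; apply; exact: strip.
Qed.
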